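(* Let $F$ be a free group of finite rank $k\ge 2$ with a fixed free basis $\Sigma$, and let $(\Phi_n)_{n\in\mathbb N}$ be a sequence of automorphisms of $F$. Then, after passing to a subsequence of $(\Phi_n)$ (still denoted $(\Phi_n)$), there exists a sequence of elements $v_n\in F$ such that the automorphisms $\Psi_n$ defined by $\Psi_n(x)=v_n\Phi_n(x)v_n^{-1}$ satisfy one and only one of the following: (1) $\Psi_n$ converges to an automorphism $\Phi$ of $F$, i.e. there is a constant subsequence $\Psi_{n_i}=\Phi$; (2) $L(\Phi_n)\to\infty$ as $n\to\infty$.
   Context: Let $A=\Sigma\cup\Sigma^{-1}$; elements of $F$ are identified with freely reduced words in $A$, and $|v|$ is the word length. $\partial F$ is the space of right-infinite freely reduced words in $A$ (geodesic rays from $1$ in the Cayley graph of $F$ with respect to $A$); for $v\in F$, $\mathrm{Cyl}(v)\subset\partial F$ is the set of rays having $v$ as initial segment ($\mathrm{Cyl}(1)=\partial F$), and these sets form a basis of the topology. $\partial^2F=\{(x,y)\in\partial F\times\partial F: x\ne y\}$ is identified with the set of oriented bi-infinite geodesics of the Cayley graph; $B\subset\partial^2F$ is the set of geodesics passing through the vertex $1$; for $x\neq y\in F$, $\mathrm{Cyl}([x,y])\subset\partial^2F$ is the set of geodesics passing through the oriented segment from $x$ to $y$ (with the correct orientation), and $\mathrm{Cyl}([1,1])=B$. $F$ acts on $\partial F$ by left translation and diagonally on $\partial^2F$. Every $\Phi\in\mathrm{Aut}(F)$ extends to a homeomorphism of $\partial F$, still denoted $\Phi$. A geodesic current is a locally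 finite $F$-invariant non-negative Borel measure on $\partial^2F$; for a current $\eta$ one writes $\Phi\eta=(\Phi\times\Phi)_*\eta$, and the length of $\eta$ is $L(\eta)=\eta(B)$. The uniform current $\eta_A$ is the geodesic current determined by $\eta_A(\mathrm{Cyl}([x,y]))=\frac{1}{2k(2k-1)^{|x^{-1}y|-1}}$ for all $x\ne y$ in $F$ (so $L(\eta_A)=1$). The length of $\Phi\in\mathrm{Aut}(F)$ is $L(\Phi)=L(\Phi\eta_A)=\eta_A\big((\Phi\times\Phi)^{-1}(B)\big)$; it depends only on the class of $\Phi$ in $\mathrm{Out}(F)$. $\mathrm{Aut}(F)$ is discrete. *)

(* Defs.v *)
From HB Require Import structures.
From mathcomp Require Import all_boot all_order all_algebra.
From mathcomp Require Import all_classical all_reals all_analysis.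

Set Implicit Arguments.
Unset Strict Implicit.
Unset Printing Implicit Defensive.

Import Order.TTheory GRing.Theory Num.Theory.
Import numFieldNormedType.Exports.

Local Open Scope classical_set_scope.
Local Open Scope group_scope.

(* A letter (s, false) stands for s and (s, true) for s^-1. *)
Definition letter (Sigma : Type) : Type := (Sigma * bool)%type.

Definition linv (Sigma : Type) (a : letter Sigma) : letter Sigma :=
  (a.1, ~~ a.2).

Lemma linvK (Sigma : Type) : involutive (@linv Sigma).
Proof. by case=> s b; rewrite /linv /= negbK. Qed.

Definition reduced (Sigma : finType) (s : seq (Sigma * bool)) : bool :=
  sorted (fun a b => b != linv a) s.

Section WordOperations.
Variable Sigma : finType.
Implicit Types (a b : Sigma * bool) (s t u : seq (Sigma * bool)).

Definition push a s : seq (Sigma * bool) :=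
  if s is b :: s' then (if b == linv a then s' else a :: s) else [:: a].

Definition mulw s t : seq (Sigma * bool) := foldr push t s.

Definition invw s : seq (Sigma * bool) := rev (map (@linv Sigma) s).

Lemma reduced_behead a s : reduced (a :: s) -> reduced s.
Proof. exact: path_sorted. Qed.

Lemma push_reduced a s : reduced s -> reduced (push a s).
Proof.
case: s => [|b s] //= rbs; case: ifPn => [_|ba]; first exact: path_sorted rbs.
by rewrite /reduced /= ba.
Qed.

Lemma push_cons a s : reduced (a :: s) -> push a s = a :: s.
Proof. by case: s => [|b s] //= /andP[/negPf ->]. Qed.

Lemma pushK a s : reduced s -> push a (push (linv a) s) = s.
Proof.
case: s => [|b s] rs; first by rewrite /= eqxx.
rewrite /= linvK; case: eqP => [ba|_] /=; last by rewrite eqxx.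
by rewrite -ba push_cons.
Qed.

Lemma mulw_reduced s t : reduced t -> reduced (mulw s t).
Proof. by move=> rt; elim: s => //= a s; apply: push_reduced. Qed.

Lemma invw_reduced s : reduced s -> reduced (invw s).
Proof.
rewrite /reduced /invw rev_sorted sorted_map.
apply: sub_sorted => a b; rewrite /relpre; apply: contra_neq.
by rewrite linvK => <-.
Qed.

Lemma push_mulw a s t : reduced t -> mulw (push a s) t = push a (mulw s t).
Proof.
case: s => [|b s] rt //=; case: eqP => [->|//].
by rewrite pushK // mulw_reduced.
Qed.

Lemma mulwA s t u : reduced u -> mulw s (mulw t u) = mulw (mulw s t) u.
Proof. by move=> ru; elim: s => //= a s ->; rewrite push_mulw. Qed.

Lemma mulw1 s : reduced s -> mulw s [::] = s.
Proof.
elim: s => //= a s IHs ras; rewrite IHs ?push_cons //.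
exact: reduced_behead ras.
Qed.

Lemma mulVw s : mulw (invw s) s = [::].
Proof.
elim: s => //= a s IHs; rewrite /invw /= rev_cons /mulw foldr_rcons /=.
by rewrite linvK eqxx.
Qed.

Lemma invwK : involutive invw.
Proof.
move=> s; rewrite /invw map_rev revK -map_comp -[RHS]map_id.
by apply: eq_map => a; apply: linvK.
Qed.

End WordOperations.

(* The free group on Sigma, realized as the group of freely reduced words. *)
Record freeGroup (Sigma : finType) := FreeGroup {
  word :> seq (Sigma * bool);
  wordP : reduced word
}.

HB.instance Definition _ (Sigma : finType) := [isSub for @word Sigma].
HB.instance Definition _ (Sigma : finType) :=
  [Choice of freeGroup Sigma by <:].

Section FreeGroupStructure.
Variable Sigma : finType.
Implicit Types x y z : freeGroup Sigma.

Definition fg_one : freeGroup Sigma := @FreeGroup Sigma [::] isT.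
Definition fg_inv x := FreeGroup (invw_reduced (wordP x)).
Definition fg_mul x y := FreeGroup (mulw_reduced x (wordP y)).

Let fg_mulA : associative fg_mul.
Proof. by move=> x y z; apply: val_inj; rewrite /= mulwA ?wordP. Qed.
Let fg_mul1 : left_id fg_one fg_mul.
Proof. by move=> x; apply: val_inj. Qed.
Let fg_mulr1 : right_id fg_one fg_mul.
Proof. by move=> x; apply: val_inj; rewrite /= mulw1 ?wordP. Qed.
Let fg_mulV : left_inverse fg_one fg_inv fg_mul.
Proof. by move=> x; apply: val_inj; rewrite /= mulVw. Qed.
Let fg_mulrV : right_inverse fg_one fg_inv fg_mul.
Proof.
by move=> x; apply: val_inj; rewrite /= -[X in mulw X _]invwK mulVw.
Qed.

HB.instance Definition _ := isGroup.Build (freeGroup Sigma)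
  fg_mulA fg_mul1 fg_mulr1 fg_mulV fg_mulrV.
HB.instance Definition _ := isPointed.Build (freeGroup Sigma) fg_one.

End FreeGroupStructure.

Definition word_length (Sigma : finType) (v : freeGroup Sigma) : nat := size v.

Record automorphism (G : groupType) := Automorphism {
  aut_fun :> G -> G;
  aut_morph : {morph aut_fun : x y / x * y};
  aut_bij : bijective aut_fun
}.

HB.instance Definition _ (G : groupType) := gen_eqMixin (automorphism G).
HB.instance Definition _ (G : groupType) := gen_choiceMixin (automorphism G).
HB.instance Definition _ (G : groupType) :=
  hasNbhs.Build (automorphism G) principal_filter.
HB.instance Definition _ (G : groupType) :=
  Discrete_ofNbhs.Build (automorphism G) erefl.

Section ConjugateAutomorphism.
Variables (G : groupType) (v : G) (Phi : automorphism G).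

Let conj_fun (x : G) : G := v * Phi x * v^-1.

Lemma conj_aut_morph : {morph conj_fun : x y / x * y}.
Proof. by move=> x y; rewrite /conj_fun aut_morph !mulgA mulgVK. Qed.

Lemma conj_aut_bij : bijective conj_fun.
Proof.
have [g gK Kg] := aut_bij Phi.
exists (fun y => g (v^-1 * y * v)) => x; rewrite /conj_fun.
  by rewrite !mulgA mulVg mul1g mulgVK gK.
by rewrite Kg !mulgA mulgV mul1g mulgK.
Qed.

Definition conjugate_aut : automorphism G := Automorphism conj_aut_morph conj_aut_bij.

End ConjugateAutomorphism.

Record boundary (Sigma : finType) := Ray {
  ray_letter :> nat -> Sigma * bool;
  ray_reduced : forall n, ray_letter n.+1 != linv (ray_letter n)
}.

HB.instance Definition _ (Sigma : finType) := gen_eqMixin (boundary Sigma).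
HB.instance Definition _ (Sigma : finType) := gen_choiceMixin (boundary Sigma).

Section Boundary.
Variable Sigma : finType.
Implicit Types (xi : boundary Sigma) (v : freeGroup Sigma).

Lemma segment_reduced xi n : reduced (mkseq xi n).
Proof.
apply/(sortedP (xi 0)) => i; rewrite size_mkseq => ltin.
by rewrite !nth_mkseq ?(ltnW ltin) // ray_reduced.
Qed.

Definition segment xi n : freeGroup Sigma := FreeGroup (segment_reduced xi n).

Definition cylinder v : set (boundary Sigma) :=
  [set xi | segment xi (word_length v) = v].

Let cylinder_cover : \bigcup_(v in [set: freeGroup Sigma]) cylinder v = setT.
Proof.
by rewrite -subTset => xi _; exists 1 => //; apply: val_inj.
Qed.

Let cylinder_join u v xi : setT u -> setT v ->
  cylinder u xi -> cylinder v xi ->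
  exists w, [/\ setT w, cylinder w xi & cylinder w `<=` cylinder u `&` cylinder v].
Proof.
move=> _ _; wlog le_uv : u v / (word_length u <= word_length v)%N => [th|].
  have [le|/ltnW le] := leqP (word_length u) (word_length v).
    exact: th le.
  move=> cu cv; have [w [_ cw sw]] := th _ _ le cv cu.
  by exists w; split=> //; rewrite setIC.
move=> cu cv; exists v; split=> // zeta cz; split=> //.
have takeE (x : boundary Sigma) : word (segment x (word_length u)) =
    take (word_length u) (segment x (word_length v)).
  by rewrite /= -map_take take_iota (minn_idPl le_uv).
by apply: val_inj => /=; rewrite [LHS]takeE cz -cv -takeE cu.
Qed.

HB.instance Definition _ := isBaseTopological.Build (boundary Sigma)
  cylinder_cover cylinder_join.

(* Convergence, in the compactification of the group by its boundary, of a
   sequence of group elements to a boundary point. *)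
Definition converges_to_ray (w : nat -> freeGroup Sigma) xi : Prop :=
  forall m, \forall n \near \oo, prefix (segment xi m) (w n).

(* The boundary map induced by a map f of the group, obtained by taking limits
   along rays. It is used when f is an automorphism or a left translation, for
   which the limit exists and is unique; xi is a default value. *)
Definition extend (f : freeGroup Sigma -> freeGroup Sigma) xi :
    boundary Sigma :=
  xget xi [set zeta | converges_to_ray (fun n => f (segment xi n)) zeta].

End Boundary.

(* Finite bases with at least two elements; their rank is #|Sigma|. *)
Structure free_basis := Basis {
  generators :> finType;
  rank_gt1 : (1 < #|generators|)%N
}.

Definition double_boundary (Sigma : free_basis) : Type :=
  set_type [set p : boundary Sigma * boundary Sigma | p.1 <> p.2].

Section DoubleBoundary.
Variable Sigma : free_basis.

HB.instance Definition _ := Topological.on (double_boundary Sigma).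

Lemma basis_inhabited : exists s : Sigma, true.
Proof.
have /card_gt0P[s _] : (0 < #|Sigma|)%N by apply: ltnW (rank_gt1 Sigma).
by exists s.
Qed.

Let constant_letter (b : bool) (n : nat) : Sigma * bool :=
  (xchoose basis_inhabited, b).

Let constant_letter_reduced b n :
  constant_letter b n.+1 != linv (constant_letter b n).
Proof. by rewrite xpair_eqE eqxx; case: b. Qed.

Let constant_ray b : boundary Sigma := Ray (constant_letter_reduced b).

Let constant_ray_neq : (constant_ray false, constant_ray true) \in
  [set p : boundary Sigma * boundary Sigma | p.1 <> p.2].
Proof.
by apply/mem_set => /(congr1 (fun x : boundary Sigma => (x 0%N).2)).
Qed.

HB.instance Definition _ := isPointed.Build (double_boundary Sigma)
  (SigSub constant_ray_neq).

(* The Borel sigma-algebra. *)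
HB.instance Definition _ := Measurable.copy (double_boundary Sigma)
  (g_sigma_algebraType (@open (double_boundary Sigma))).

Definition source (p : double_boundary Sigma) : boundary Sigma := (\val p).1.
Definition target (p : double_boundary Sigma) : boundary Sigma := (\val p).2.

(* Bi-infinite geodesics of the Cayley graph, by their sequence of vertices. *)
Definition is_geodesic (gamma : int -> freeGroup Sigma) : Prop :=
  forall i j : int, word_length ((gamma i)^-1 * gamma j) = `|i - j|%N.

Definition is_geodesic_from_to (gamma : int -> freeGroup Sigma)
    (p : double_boundary Sigma) : Prop :=
  [/\ is_geodesic gamma,
      converges_to_ray (fun n : nat => gamma (- n%:Z)%R) (source p) &
      converges_to_ray (fun n : nat => gamma n%:Z%R) (target p)].

(* cylinder2 1 1 is the set of geodesics passing through the vertex 1. *)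
Definition cylinder2 (x y : freeGroup Sigma) : set (double_boundary Sigma) :=
  [set p | exists gamma, is_geodesic_from_to gamma p /\
     exists i j : int, [/\ (i <= j)%R, gamma i = x & gamma j = y]].

(* The diagonal map induced by f; as for extend, p is a default value, not
   used when extend f is injective. *)
Definition extend2 (f : freeGroup Sigma -> freeGroup Sigma)
    (p : double_boundary Sigma) : double_boundary Sigma :=
  xget p [set q | source q = extend f (source p) /\
                  target q = extend f (target p)].

End DoubleBoundary.

Section Currents.
Variables (R : realType) (Sigma : free_basis).
Local Open Scope ring_scope.
Local Open Scope ereal_scope.

Definition is_current
    (eta : {measure set (double_boundary Sigma) -> \bar R}) : Prop :=
  (forall p, exists U : set (double_boundary Sigma),
     [/\ open U, U p & eta U < +oo]) /\
  (forall (v : freeGroup Sigma) (E : set (double_boundary Sigma)),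
     measurable E -> pushforward eta (extend2 (fun w => (v * w)%g)) E = eta E).

Definition current_length (eta : set (double_boundary Sigma) -> \bar R) :
    \bar R :=
  eta (cylinder2 1%g 1%g).

Definition is_uniform_current
    (eta : {measure set (double_boundary Sigma) -> \bar R}) : Prop :=
  is_current eta /\
  forall x y : freeGroup Sigma, x <> y ->
    eta (cylinder2 x y) =
    (let k : R := #|Sigma|%:R in
     1 / (2 * k * (2 * k - 1) ^+ (word_length (x^-1 * y)%g - 1)))%R%:E.

Definition aut_length (eta_A : {measure set (double_boundary Sigma) -> \bar R})
    (Phi : automorphism (freeGroup Sigma)) : \bar R :=
  current_length (pushforward eta_A (extend2 Phi)).

End Currents.

(* Main.v *)
(* Write [N] for the maximal length of the image of a letter under [Phi], and
   view [Phi] as an equivariant map between two copies of the Cayley tree.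
   Folding this map shows that its cancellation is at most [2k(N+1)+1], whence
   the boundary map, its continuity, and a bound on [L] that is uniform over the
   conjugates of [Phi].  Conversely let [Phi] minimize the total length of the
   images of the letters among its conjugates.  Then at most half of these images
   start with the same letter, so a letter [a] with [|Phi(a)| = N] can be
   alternated with a letter [b] in such a way that the images do not cancel; for
   [w = (ab)^m] with [m] of order [8k], the word [Phi(w)] is so long that at
   least [N] of its vertices lie out of the reach of cancellation.  Each of them
   yields a translate of [Cyl([1,w])] mapped to geodesics through a prescribed
   vertex, a positive proportion of these translates are disjoint, and so
   [L(Phi) >= eps N] with [eps] depending on [k] only.  Choosing minimal
   representatives [Psi_n], either [N] is bounded along a subsequence, so that some
   automorphism occurs infinitely often, or [N], and with it [L], goes to
   infinity. *)
Require Import Defs.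
From HB Require Import structures.
From mathcomp Require Import all_boot all_order all_algebra.
From mathcomp Require Import all_classical all_reals all_analysis.
From mathcomp Require Import zify.

Set Implicit Arguments.
Unset Strict Implicit.
Unset Printing Implicit Defensive.


(** * Word metric and segments in the Cayley tree *)

Section TreeMetric.
Local Open Scope nat_scope.
Local Open Scope group_scope.
Variable Sigma : finType.
Implicit Types (a b : Sigma * bool) (s t u : seq (Sigma * bool)).
Local Notation F := (freeGroup Sigma).
Implicit Types (x y z p q g h : F).

(** On reduced words this is the Gromov product of two vertices based at 1. *)
Fixpoint lcp s t : nat :=
  match s, t with
  | a :: s', b :: t' => if a == b then (lcp s' t').+1 else 0
  | _, _ => 0
  end.

Definition dist x y : nat := size (word (x^-1 * y)).

Lemma size_invw s : size (invw s) = size s.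
Proof. by rewrite /invw size_rev size_map. Qed.

Lemma word_mul x y : word (x * y) = mulw x y.
Proof. by []. Qed.

Lemma word_inv x : word x^-1 = invw x.
Proof. by []. Qed.

Lemma mulw_cat s t : reduced (s ++ t) -> mulw s t = s ++ t.
Proof.
elim: s => //= a s IHs rast; rewrite IHs ?push_cons //.
exact: reduced_behead rast.
Qed.

(** The cancellation in [s^-1 t] removes exactly the common prefix, once from each factor; as soon
    as the first letters differ, the concatenation is reduced. *)
Lemma size_mulVw s t : reduced s -> reduced t ->
  (size (mulw (invw s) t) + 2 * lcp s t = size s + size t)%N.
Proof.
elim: s t => [|a s IHs] t rs rt; first by rewrite muln0 addn0.
case: t rt => [|b t] rt.
- by rewrite muln0 !addn0 mulw1 ?size_invw ?invw_reduced.
- rewrite /=; have rs' := reduced_behead rs; have rt' := reduced_behead rt.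
  have [eab|nab] := eqVneq a b.
    rewrite -{}eab in rt rt' *; rewrite /invw /= rev_cons /mulw foldr_rcons /= linvK eqxx.
    by have := IHs t rs' rt'; rewrite /mulw /invw; lia.
  rewrite mulw_cat ?size_cat ?size_invw ?muln0 ?addn0 //.
  have := invw_reduced rs; rewrite /invw /= rev_cons /reduced.
  case: (rev _) => [|c u] /=; first by rewrite linvK eq_sym nab.
  rewrite cat_rcons cat_path rcons_path /= => /andP[-> ->] /=.
  by rewrite linvK eq_sym nab.
Qed.

Lemma lcpC s t : lcp s t = lcp t s.
Proof. by elim: s t => [|a s IHs] [|b t] //=; rewrite eq_sym IHs. Qed.

Lemma lcp_ultra s t u : (minn (lcp s t) (lcp t u) <= lcp s u)%N.
Proof.
elim: s t u => [|a s IHs] [|b t] [|c u] //=; rewrite ?minn0 ?min0n //.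
case: (eqVneq a b) => [->|_]; last by rewrite min0n.
case: (eqVneq b c) => [_|_]; last by rewrite minn0.
by rewrite minnSS ltnS.
Qed.

Lemma lcp_prefix s t : prefix s t = (lcp s t == size s).
Proof.
elim: s t => [|a s IHs] [|b t] //=; rewrite IHs.
by case: (a == b).
Qed.

Lemma lcp_le s t : (lcp s t <= size s)%N.
Proof. by elim: s t => [|a s IHs] [|b t] //=; case: ifP => // _; apply: IHs. Qed.

Lemma dist_lcp x y : (dist x y + 2 * lcp x y = size x + size y)%N.
Proof. by rewrite /dist word_mul word_inv size_mulVw ?wordP. Qed.

Lemma dist1 x : dist 1 x = size x.
Proof. by rewrite /dist invg1 mul1g. Qed.

Lemma distC x y : dist x y = dist y x.
Proof. by have := dist_lcp x y; have := dist_lcp y x; rewrite lcpC; lia. Qed.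

Lemma distM g x y : dist (g * x) (g * y) = dist x y.
Proof. by rewrite /dist invgM -mulgA mulKg. Qed.

Lemma distxx x : dist x x = 0.
Proof. by rewrite /dist mulVg. Qed.

Lemma dist_eq0 x y : dist x y = 0 -> x = y.
Proof.
move=> /size0nil e; have : x^-1 * y = 1 by apply: val_inj.
by move/(congr1 (fun g => x * g)); rewrite mulVKg mulg1.
Qed.

(** The four-point condition of a tree. Translating [p] to 1 turns it into the ultrametric
    inequality for [lcp]. *)
Lemma dist_four x y z p :
  (dist x y + dist z p <= maxn (dist x z + dist y p) (dist x p + dist y z))%N.
Proof.
have tr g h : dist g h = dist (p^-1 * g) (p^-1 * h) by rewrite distM.
rewrite !(tr x) !(tr y) !(tr z) !mulVg ![dist _ 1]distC !dist1.
set X := p^-1 * x; set Y := p^-1 * y; set Z := p^-1 * z.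
have := dist_lcp X Y; have := dist_lcp X Z; have := dist_lcp Y Z.
by have := lcp_ultra X Z Y; rewrite (lcpC Z Y); lia.
Qed.

Lemma dist_triangle x y z : (dist x z <= dist x y + dist y z)%N.
Proof. by have := dist_four x z y y; rewrite distxx; rewrite (distC z y); lia. Qed.

Definition btw p x y : bool := (dist x p + dist p y == dist x y)%N.

Lemma btwP p x y : btw p x y -> (dist x p + dist p y = dist x y)%N.
Proof. by move/eqP. Qed.

Lemma btwC p x y : btw p x y = btw p y x.
Proof. by rewrite /btw addnC (distC p y) (distC x p) (distC x y). Qed.

Lemma btwM g p x y : btw (g * p) (g * x) (g * y) = btw p x y.
Proof. by rewrite /btw !distM. Qed.

(** Triangles are tripods, so each side is covered by the other two. *)
Lemma btw_split p x y z : btw p x z -> btw p x y || btw p y z.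
Proof.
rewrite /btw; have := dist_four x z y p; have := dist_triangle x p y.
have := dist_triangle y p z; rewrite (distC z p) (distC y p) (distC z y); lia.
Qed.

Lemma btw_left p q x y : btw p x y -> btw q x p -> btw q x y.
Proof.
rewrite /btw; have := dist_triangle q p y; have := dist_triangle x q y; lia.
Qed.

Lemma btw_right p q x y : btw p x y -> btw q p y -> btw q x y.
Proof. by rewrite btwC (btwC q p) (btwC q x); apply: btw_left. Qed.

Lemma btw_midl p q x y : btw p x y -> btw q x p -> btw p q y.
Proof.
rewrite /btw; have := dist_triangle x q y; have := dist_triangle q p y; lia.
Qed.

Lemma btw_midr p q x y : btw p x y -> btw q p y -> btw p x q.
Proof. by rewrite btwC (btwC q p) (btwC p x); apply: btw_midl. Qed.

Lemma btw_endr x y : btw y x y.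
Proof. by rewrite /btw distxx addn0. Qed.

Lemma btw_same p x : btw p x x -> p = x.
Proof. by rewrite /btw distxx => h; apply: dist_eq0; rewrite distC; lia. Qed.

Lemma dist_mulr x g : dist x (x * g) = size g.
Proof. by rewrite -{1}(mulg1 x) distM dist1. Qed.

Lemma reduced_take n x : reduced (take n x).
Proof. exact: (@take_sorted _ _ n _ (wordP x)). Qed.
Definition ftake n x : F := FreeGroup (reduced_take n x).

Lemma lcp_takel n s : (n <= size s)%N -> lcp (take n s) s = n.
Proof. by elim: s n => [|a s IHs] [|n] //= ns; rewrite eqxx IHs. Qed.

Lemma ftake_btw n x : (n <= size x)%N -> btw (ftake n x) 1 x.
Proof.
move=> nx; rewrite /btw !dist1; have := dist_lcp (ftake n x) x.
by rewrite /= lcp_takel // size_takel //; lia.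
Qed.

Lemma btw_exists x y n : (n <= dist x y)%N ->
  exists2 p, btw p x y & dist x p = n.
Proof.
move=> nxy; exists (x * ftake n (x^-1 * y)).
  by rewrite -(btwM x^-1) mulKg mulVg ftake_btw.
by rewrite dist_mulr size_takel.
Qed.

Lemma btw_uniq p q x y : btw p x y -> btw q x y -> dist x p = dist x q -> p = q.
Proof.
move=> /btwP bp /btwP bq e; apply: dist_eq0.
have := dist_four p q x y; rewrite (distC p x) (distC q x); lia.
Qed.

End TreeMetric.

(** * Strictly increasing chains of equivalence relations on a finite set *)

Section EquivalenceChain.
Local Open Scope nat_scope.
Variables (I : finType) (E : nat -> I -> I -> Prop).
Hypothesis E_refl : forall t i, E t i i.
Hypothesis E_sym : forall t i j, E t i j -> E t j i.
Hypothesis E_trans : forall t j i k, E t i j -> E t j k -> E t i k.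
Hypothesis E_mono : forall t i j, E t i j -> E t.+1 i j.

Let rep t : {set I} :=
  [set i | `[< forall j, E t i j -> (enum_rank i <= enum_rank j)%N >]].

Let rep_exists t i : exists2 r, r \in rep t & E t i r.
Proof.
case: (@arg_minnP _ i (fun j => `[< E t i j >])
  (fun j => nat_of_ord (enum_rank j))); first exact/asboolP.
move=> r /asboolP Eir rmin; exists r => //; rewrite inE; apply/asboolP => j Erj.
by apply: rmin; apply/asboolP; apply: E_trans Erj.
Qed.

Let rep_uniq t i j : i \in rep t -> j \in rep t -> E t i j -> i = j.
Proof.
rewrite !inE => /asboolP ri /asboolP rj Eij; apply: enum_rank_inj.
by apply/val_inj/eqP; rewrite eqn_leq /= ri // rj //; apply: E_sym.
Qed.

(* Each class has exactly one representative, and every strict coarsening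
   loses one. *)
Lemma equivalence_chain_length n :
    (forall t, t < n -> exists i j, E t.+1 i j /\ ~ E t i j) ->
  n <= #|I|.
Proof.
(* The induction keeps track of the number of classes that remain at time [n]. *)
move=> strict; suff: n + #|rep n| <= #|I| by lia.
elim: n strict => [|n IHn] strict; first exact: max_card.
apply: leq_trans (IHn (fun t tn => strict t (ltnW tn))).
rewrite addSnnS leq_add2l; apply: proper_card; apply/properP; split.
  apply/fintype.subsetP => i; rewrite !inE => /asboolP ri; apply/asboolP => j Eij.
  exact/ri/E_mono.
have [i [j [Eij nEij]]] := strict n (ltnSn n).
have [r rr Eir] := rep_exists n i; have [s rs Ejs] := rep_exists n j.
have Ers : E n.+1 r s.
  by apply: (E_trans (E_sym (E_mono Eir))); apply: E_trans (E_mono Ejs).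
have [rr'|] := boolP (r \in rep n.+1); last by exists r.
have [rs'|] := boolP (s \in rep n.+1); last by exists s.
case: nEij; apply: E_trans Eir _; rewrite (rep_uniq rr' rs' Ers).
exact: E_sym.
Qed.

End EquivalenceChain.

(** * Bounded cancellation by folding *)

Section BoundedCancellation.
Local Open Scope nat_scope.
Local Open Scope group_scope.
Variable Sigma : finType.
Local Notation F := (freeGroup Sigma).
Implicit Types (x y z p q g h v : F) (a b : Sigma * bool).

Definition free_letter a : F := @FreeGroup Sigma [:: a] isT.

Lemma last_letter y x : y <> x ->
  exists g a, [/\ x = g * free_letter a, btw g y x & (dist y x = (dist y g).+1)%N].
Proof.
move=> nyx; have d0 : (0 < dist y x)%N.
  by rewrite lt0n; apply/eqP => /dist_eq0.
have [g bg dg] := btw_exists (leq_pred (dist y x)).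
have := btwP bg; rewrite dg {1}/dist => /esym d1.
have : size (word (g^-1 * x)) = 1%N by rewrite /dist in d0 d1 *; lia.
case e : (word _) => [|a [|b s]] // _; exists g, a; split=> //; last by lia.
by rewrite -[LHS](mulVKg g); congr (_ * _); apply: val_inj.
Qed.

Variable Phi : F -> F.
Hypothesis PhiM : {morph Phi : x y / x * y}.
Hypothesis Phi_inj : injective Phi.

Lemma morph1 : Phi 1 = 1.
Proof. by apply: (@mulgI _ (Phi 1)); rewrite -PhiM !mulg1. Qed.

Lemma morphV x : Phi x^-1 = (Phi x)^-1.
Proof. by apply: (@mulgI _ (Phi x)); rewrite -PhiM !mulgV morph1. Qed.

(** Shorten [x] along the path from [y] as long as [p] stays on the image segment. When this stops,
    [p] is not between [Phi y] and the image of the last but one vertex, hence lies on the image of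
    the last edge. *)
Lemma first_edge p y x : p <> Phi y -> btw p (Phi y) (Phi x) ->
  exists g a, [/\ btw g y x, btw (g * free_letter a) y x,
    dist y (g * free_letter a) = (dist y g).+1,
    btw p (Phi g) (Phi (g * free_letter a)) &
    forall v, btw v y g -> ~~ btw p (Phi y) (Phi v)].
Proof.
move=> npy; have [n] := ubnP (dist y x); elim: n x => // n IHn x; rewrite ltnS.
move=> dn bp.
have [[v [bv nvx bpv]]|none] := pselect
  (exists v, [/\ btw v y x, v <> x & btw p (Phi y) (Phi v)]).
  have dv : (0 < dist v x)%N by rewrite lt0n; apply/eqP => /dist_eq0.
  have dyv := btwP bv.
  have [|g [a [b1 b2 d p' nv]]] := IHn v _ bpv; first by lia.
  by exists g, a; split=> //; apply: btw_left bv _.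
have nyx : y <> x.
  by move=> e; apply: npy; rewrite e in bp *; apply: btw_same.
have [g [a [ex bg dg]]] := last_letter nyx.
have nb v : btw v y g -> ~~ btw p (Phi y) (Phi v).
  move=> bv; apply/negP => bpv; apply: none; exists v; split=> //.
    exact: btw_left bv.
  by move=> evx; rewrite evx /btw in bv; lia.
exists g, a; rewrite -ex; split=> //; first exact: btw_endr.
have /orP[|//] := btw_split (Phi g) bp.
by rewrite (negPf (nb g (btw_endr y g))).
Qed.

Variable N : nat.
Hypothesis PhiN : forall a, (size (Phi (free_letter a)) <= N)%N.

Lemma dist_morph g h : (dist (Phi g) (Phi h) <= dist g h * N)%N.
Proof.
have [n] := ubnP (dist g h); elim: n h => // n IHn h; rewrite ltnS => dn.
have [->|ngh] := pselect (g = h); first by rewrite !distxx.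
have [k [a [eh bk dk]]] := last_letter ngh.
rewrite dk mulSn addnC; apply: leq_trans (dist_triangle _ (Phi k) _) _.
apply: leq_add; first by apply: IHn; lia.
by rewrite eh PhiM dist_mulr.
Qed.

Lemma edge_point p g a : btw p (Phi g) (Phi (g * free_letter a)) ->
  exists n : 'I_N.+1, p = Phi g * ftake n (Phi (free_letter a)).
Proof.
move=> bp; have d := btwP bp.
have dN : (dist (Phi g) p <= size (Phi (free_letter a)))%N.
  by have := dist_mulr (Phi g) (Phi (free_letter a)); rewrite -PhiM; lia.
have dNS : (dist (Phi g) p < N.+1)%N.
  by rewrite ltnS; apply: leq_trans dN (PhiN a).
exists (Ordinal dNS); apply: (btw_uniq bp).
  by rewrite -(btwM (Phi g)^-1) PhiM !mulKg mulVg; apply: ftake_btw.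
by rewrite dist_mulr /= size_takel.
Qed.

Let I : finType := ((Sigma * bool) * 'I_N.+1)%type.
Implicit Types i j k : I.

(* The subdivision vertices of the image edge [1, Phi a]; the subdivided Cayley
   tree has the vertices (g, i), mapped to Phi g * subdiv i. *)
Let subdiv i : F := ftake i.2 (Phi (free_letter i.1)).

(* Vertices are identified at time t if they have the same image and the image
   of the path joining them stays within distance t of it. *)
Let fold t i j : Prop := i = j \/ exists g, Phi g * subdiv j = subdiv i /\
  forall v, btw v 1 g -> (dist (Phi v) (subdiv i) <= t)%N.

Let fold_sym t i j : fold t i j -> fold t j i.
Proof.
case=> [->|[g [eg vg]]]; first by left.
right; exists g^-1; split=> [|v bv]; first by rewrite -eg morphV mulKg.
rewrite -(distM (Phi g)) eg -PhiM; apply: vg.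
by rewrite -(btwM g) mulg1 mulgV in bv; rewrite btwC.
Qed.

Let fold_trans t j i k : fold t i j -> fold t j k -> fold t i k.
Proof.
case=> [->//|[g [eg vg]]] [<-|[h [eh vh]]]; first by right; exists g.
right; exists (g * h); split=> [|v bv]; first by rewrite PhiM -mulgA eh.
have /orP[/vg//|bv'] := btw_split g bv.
rewrite -eg -[v](mulVKg g) PhiM distM; apply: vh.
by rewrite -(btwM g) mulVKg mulg1.
Qed.

Let fold_mono t i j : fold t i j -> fold t.+1 i j.
Proof.
case=> [->|[g [eg vg]]]; first by left.
by right; exists g; split=> // v /vg; lia.
Qed.

(** If the image of the path from [x] to [z] backtracks at [Phi y] by at least [t+1], two points of
    the subdivided tree, one on each side of [y], are folded together at time [t+1] and not
    before. *)
Let fold_strict x y z t : btw y x z ->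
    (forall v, btw v x z -> dist (Phi v) (Phi x) + dist (Phi v) (Phi z) <=
                            dist (Phi y) (Phi x) + dist (Phi y) (Phi z))%N ->
    (2 * t.+1 + dist (Phi x) (Phi z) <=
       dist (Phi y) (Phi x) + dist (Phi y) (Phi z))%N ->
  exists i j, fold t.+1 i j /\ ~ fold t i j.
Proof.
move=> byxz ymax et; have tri := dist_triangle (Phi y) (Phi x) (Phi z).
have [|p bpx dp] := @btw_exists _ (Phi y) (Phi x) t.+1; first by lia.
(* The segments from [Phi y] to [Phi x] and to [Phi z] share at least their first [t+1] edges, so
   [p] lies on both. *)
have bpz : btw p (Phi y) (Phi z).
  have := dist_four p (Phi z) (Phi y) (Phi x).
  have := dist_triangle (Phi y) p (Phi z).
  rewrite /btw in bpx *; rewrite (distC p (Phi y)) (distC (Phi z) (Phi x)).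
  rewrite (distC (Phi z) (Phi y)); lia.
have npy : p <> Phi y by move=> e; rewrite e distxx in dp.
have [g [a [gyx gayx dga bpg gfirst]]] := first_edge npy bpx.
have [h [b [hyz hbyz dhb bph hfirst]]] := first_edge npy bpz.
have [m pm] := edge_point bpg; have [n pn] := edge_point bph.
exists (a, m), (b, n).
have byx u v : btw u y x -> btw v y u -> btw v x z.
  move=> bu /(btw_left bu) bv; rewrite btwC in bv; exact: btw_left bv.
have byz u v : btw u y z -> btw v y u -> btw v x z.
  move=> bu /(btw_left bu); exact: btw_right.
split; first right.
  exists (g^-1 * h); split.
    by rewrite PhiM morphV -mulgA -pn pm mulKg.
  move=> v; rewrite -(btwM g) mulg1 mulVKg => bv.
  rewrite -(distM (Phi g)) -pm -PhiM; move: (g * v) bv => {}v bv.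
  (* Since [p] does not separate [Phi v] from [Phi y], it separates [Phi v] from [Phi x] and from
     [Phi z]; the maximality of [y] then gives [dist (Phi v) p <= dist (Phi y) p], which is
     [t+1]. *)
  have [bvxz nv] : btw v x z /\ ~~ btw p (Phi y) (Phi v).
    have /orP[bv'|bv'] := btw_split y bv.
      rewrite btwC in bv'; split; [exact: byx bv'|exact: gfirst].
    split; [exact: byz bv'|exact: hfirst].
  have /orP[|/btwP bx] := btw_split (Phi v) bpx; first by rewrite (negPf nv).
  have /orP[|/btwP bz] := btw_split (Phi v) bpz; first by rewrite (negPf nv).
  move: (ymax v bvxz) (btwP bpx) (btwP bpz) bx bz dp; clear; lia.
have ygh : btw y g h.
  by apply: btw_midr hyz; apply: btw_midl byxz _; rewrite btwC.
(* Equal indices would force [g = h = y], so that one edge would leave [y] in both directions.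
   Otherwise the folding element is [g^-1 h], and its path visits [g^-1 y], whose image is at
   distance [t+1]. *)
case=> [[eab emn]|[k [ek vk]]].
  subst b n; have egh : g = h.
    by apply: Phi_inj; apply: (@mulIg _ (subdiv (a, m))); rewrite -pm -pn.
  subst h; move/btw_same: ygh => egy; subst g; rewrite distxx in dga.
  rewrite btwC in gayx.
  have := btw_midr (btw_midl byxz gayx) hbyz.
  by move=> /btw_same e; rewrite -e distxx in dga.
have ekgh : k = g^-1 * h.
  apply: Phi_inj; rewrite PhiM morphV; apply: (@mulIg _ (subdiv (b, n))).
  by rewrite ek -mulgA -pn pm mulKg.
have := vk (g^-1 * y); rewrite -(btwM g) ekgh mulg1 !mulVKg => /(_ ygh).
by rewrite -(distM (Phi g)) -PhiM mulVKg -pm dp ltnn.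
Qed.

(** At a point of the path with maximal backtracking, every unit of depth is a strict step in the
    chain of folding relations on [I], so the depth is at most the cardinality of [I]. The final
    successor absorbs the rounding of the division by 2. *)
Lemma bounded_cancellation x y z : btw y x z ->
  (dist (Phi y) (Phi x) + dist (Phi y) (Phi z) <=
     dist (Phi x) (Phi z) + 2 * (2 * #|Sigma| * N.+1).+1)%N.
Proof.
have -> : (2 * #|Sigma| * N.+1 = #|I|)%N.
  by rewrite !card_prod card_bool card_ord (mulnC 2).
move=> byxz; pose e v := (dist (Phi v) (Phi x) + dist (Phi v) (Phi z))%N.
pose P n := `[< exists2 v, btw v x z & e v = n >].
have Pe : exists n, P n by exists (e y); apply/asboolP; exists y.
(* A crude Lipschitz bound, which ensures that the maximum exists. *)
have Pb n : P n -> (n <= 2 * (dist x z * N))%N.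
  move=> /asboolP[v /btwP bv <-]; have := dist_morph v x; have := dist_morph v z.
  rewrite (distC v x) -bv mulnDl /e; lia.
have [n /asboolP[v bv ev] nmax] := ex_maxnP Pe Pb.
have vmax u : btw u x z -> (e u <= e v)%N.
  by move=> bu; rewrite ev; apply: nmax; apply/asboolP; exists u.
apply: leq_trans (vmax y byxz) _.
have chain := equivalence_chain_length (fun t i => or_introl erefl)
  fold_sym fold_trans fold_mono.
set m := ((e v - dist (Phi x) (Phi z)) %/ 2)%N.
suff : (m <= #|I|)%N by rewrite /m; lia.
apply: chain => t tm; apply: (fold_strict bv vmax).
rewrite -/(e v). rewrite /m in tm; lia.
Qed.

End BoundedCancellation.

(** * Cancellation and properness of an automorphism *)

Section Cancellation.
Local Open Scope nat_scope.
Local Open Scope group_scope.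
Variable Sigma : finType.
Local Notation F := (freeGroup Sigma).
Implicit Types (x y z p q g h v : F) (a b : Sigma * bool).
Variable Phi : automorphism F.

Lemma aut_inj : injective Phi.
Proof. exact: bij_inj (aut_bij Phi). Qed.

Lemma aut_surj y : exists x, Phi x = y.
Proof. by have [f _ fK] := aut_bij Phi; exists (f y). Qed.

Definition stretch : nat := \max_(a : Sigma * bool) size (Phi (free_letter a)).
(** Half of the excess in [bounded_cancellation]: the image of a point of a segment is within this
    distance of the segment between the images of its ends. *)
Definition bcc : nat := (2 * #|Sigma| * stretch.+1).+1.

Lemma stretch_max a : (size (Phi (free_letter a)) <= stretch)%N.
Proof. exact: (leq_bigmax (F := fun a => size (Phi (free_letter a)))). Qed.

Lemma bccP x y z : btw y x z ->
  (dist (Phi y) (Phi x) + dist (Phi y) (Phi z) <=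
     dist (Phi x) (Phi z) + 2 * bcc)%N.
Proof. exact: bounded_cancellation (aut_morph Phi) aut_inj _ stretch_max _ _ _. Qed.

(** If [p] were on both image segments leaving [Phi y], the image of the path from [x] to [z] would
    backtrack at [Phi y] beyond the cancellation bound. *)
Lemma bcc_avoid x y z p : btw y x z -> (bcc < dist (Phi y) p)%N ->
  btw p (Phi y) (Phi z) -> ~~ btw p (Phi y) (Phi x).
Proof.
move=> /bccP byxz dp /btwP bz; apply/negP => /btwP bx.
have := dist_triangle (Phi x) p (Phi z); rewrite (distC (Phi x) p); lia.
Qed.

(** The inverse automorphism is Lipschitz, so long words cannot have short images. *)
Lemma aut_escape r : exists n, forall x, (n <= size x -> r <= size (Phi x))%N.
Proof.
have [f fK Kf] := aut_bij Phi.
have fM : {morph f : x y / x * y}.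
  by move=> x y; apply: aut_inj; rewrite aut_morph !Kf.
have f1 : f 1 = 1 by rewrite (morph1 fM).
pose N := \max_(a : Sigma * bool) size (f (free_letter a)).
have NP a : (size (f (free_letter a)) <= N)%N.
  exact: (leq_bigmax (F := fun a => size (f (free_letter a)))).
exists (r * N).+1 => x nx; rewrite leqNgt; apply/negP => lt.
have := dist_morph fM NP 1 (Phi x); rewrite fK f1 !dist1.
have : (size (Phi x) * N <= r * N)%N by rewrite leq_mul // ltnW.
lia.
Qed.

End Cancellation.

(** * Rays and their initial segments *)

Section Rays.
Local Open Scope nat_scope.
Local Open Scope group_scope.
Variable Sigma : finType.
Local Notation F := (freeGroup Sigma).
Implicit Types (x y z p q g h v : F) (xi zeta : boundary Sigma).

Lemma ray_eq xi zeta : (forall n, xi n = zeta n) -> xi = zeta.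
Proof.
case: xi zeta => [f fr] [g gr] /= /funext fg; rewrite fg in fr *.
by congr Ray; apply: Prop_irrelevance.
Qed.

Lemma size_segment xi n : size (segment xi n) = n.
Proof. exact: size_mkseq. Qed.

Lemma ftake_segment xi m n : m <= n -> ftake m (segment xi n) = segment xi m.
Proof.
move=> mn; apply: val_inj => /=.
by rewrite /mkseq -map_take take_iota (minn_idPl mn).
Qed.

Lemma segment_btw xi m n : m <= n -> btw (segment xi m) 1 (segment xi n).
Proof. by move=> mn; rewrite -(ftake_segment _ mn) ftake_btw ?size_segment. Qed.

Lemma prefix_btw x y : prefix x y = btw x 1 y.
Proof.
rewrite lcp_prefix /btw !dist1; have := dist_lcp x y; have := lcp_le x y; lia.
Qed.

Lemma segment_letter xi zeta n : segment xi n.+1 = segment zeta n.+1 -> xi n = zeta n.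
Proof.
move=> /(congr1 (fun x => nth (xi 0) (word x) n)).
by rewrite /= !nth_mkseq.
Qed.

Lemma segment_inj xi zeta : (forall n, segment xi n = segment zeta n) -> xi = zeta.
Proof. by move=> e; apply: ray_eq => n; apply: segment_letter. Qed.

Lemma lcp_take r (s t : seq (Sigma * bool)) : r <= lcp s t -> take r s = take r t.
Proof.
elim: s t r => [|a s IHs] [|b t] [|r] //=; case: eqP => // -> /IHs ->.
by [].
Qed.

Lemma ftake_ftake m n x : m <= n -> ftake m (ftake n x) = ftake m x.
Proof. by move=> mn; apply: val_inj; rewrite /= take_takel. Qed.

(** A Cauchy criterion: the prefixes of each length stabilize, and the stable ones are nested, so
    they spell a ray. The letter [d] is the default value of [nth]. *)
Lemma converges_exists (d : Sigma * bool) (w : nat -> F) :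
    (forall r, exists n0, forall n, n0 <= n -> r <= lcp (w n0) (w n)) ->
  exists xi, converges_to_ray w xi.
Proof.
move=> /boolp.choice[n0 n0P]; pose u r := ftake r (w (n0 r)).
have wu r n : n0 r <= n -> ftake r (w n) = u r.
  by move=> /n0P/lcp_take e; apply: val_inj; rewrite /= e.
have size_u r : size (u r) = r.
  by rewrite /= size_takel //; apply: leq_trans (n0P r _ (leqnn _)) (lcp_le _ _).
have uu m n : m <= n -> ftake m (u n) = u m.
  move=> mn; rewrite -(wu n (maxn (n0 m) (n0 n))) ?leq_maxr //.
  by rewrite ftake_ftake // wu // leq_maxl.
pose f n := nth d (u n.+1) n.
have fu m n : m < n -> nth d (u n) m = f m.
  move=> mn; rewrite /f (_ : word (u m.+1) = take m.+1 (u n)) ?nth_take //.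
  by rewrite -(uu _ _ mn).
have fr n : f n.+1 != linv (f n).
  rewrite -(fu n n.+2) //; have /(sortedP d)/(_ n) := wordP (u n.+2).
  by rewrite size_u ltnSn => /(_ isT).
exists (Ray fr) => r; exists (n0 r) => // n rn.
rewrite (_ : segment (Ray fr) r = u r); first by rewrite -(wu _ _ rn) prefix_take.
apply: val_inj; apply: (@eq_from_nth _ d); rewrite ?size_mkseq ?size_u // => i ir.
by rewrite nth_mkseq //= -(fu i r).
Qed.

End Rays.

(** * The boundary map of an automorphism *)

Section Extension.
Local Open Scope nat_scope.
Local Open Scope group_scope.
Variable Sigma : finType.
Local Notation F := (freeGroup Sigma).
Implicit Types (x y z p q g h v : F) (xi zeta : boundary Sigma).
Variable Phi : automorphism F.

(** Bounded cancellation at [segment xi m], a point between 1 and [segment xi n]: later letters of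
    the ray erase at most [bcc Phi] letters of the image. *)
Lemma lcp_aut_segment xi m n : (m <= n)%N ->
  (size (Phi (segment xi m)) <=
     lcp (Phi (segment xi m)) (Phi (segment xi n)) + bcc Phi)%N.
Proof.
move=> /(segment_btw xi)/(bccP Phi); rewrite (morph1 (aut_morph Phi)) dist1.
rewrite distC dist1; have := dist_lcp (Phi (segment xi m)) (Phi (segment xi n)).
lia.
Qed.

(** Images of initial segments grow without bound and lose boundedly many letters, so the limit
    exists and the default in [extend] is not taken. *)
Lemma extendP xi : converges_to_ray (fun n => Phi (segment xi n)) (extend Phi xi).
Proof.
rewrite /extend.
have [|zeta zetaP] := @converges_exists _ (xi 0) (fun n => Phi (segment xi n)).
  move=> r; have [n nP] := aut_escape Phi (r + bcc Phi); exists n => m nm.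
  have := lcp_aut_segment xi nm; have := nP (segment xi n).
  rewrite size_segment; lia.
exact: (xgetPex xi (ex_intro _ zeta zetaP)).
Qed.

End Extension.

(** * Bi-infinite geodesics and their cylinders *)

Section Geodesics.
Local Open Scope classical_set_scope.
Local Open Scope nat_scope.
Local Open Scope group_scope.
Variable Sigma : free_basis.
Local Notation F := (freeGroup Sigma).
Implicit Types (x y z c g h u v : F) (xi zeta : boundary Sigma).
Implicit Types p q : double_boundary Sigma.

Definition src p n : F := segment (source p) n.
Definition tgt p n : F := segment (target p) n.

Lemma open_cylinder v : open (cylinder v).
Proof. by exists [set v] => //; rewrite bigcup_set1. Qed.

(** Products of two cylinders, restricted to pairs of distinct rays, are neighbourhoods; openness is
    thus a condition on finite initial segments. *)
Lemma open_local (S : set (double_boundary Sigma)) :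
    (forall p, S p -> exists n, forall q,
       src q n = src p n -> tgt q n = tgt p n -> S q) ->
  open S.
Proof.
move=> locS; rewrite openE => p /locS[n nS].
have cyl xi : nbhs xi (cylinder (segment xi n)).
  apply: open_nbhs_nbhs; split; first exact: open_cylinder.
  by rewrite /cylinder /= /word_length size_segment.
have /(@initial_continuous _ _ set_val p) : nbhs (\val p)
    (cylinder (src p n) `*` cylinder (tgt p n)).
  by exists (cylinder (src p n), cylinder (tgt p n)) => //; split; apply: cyl.
move=> nb; apply: (@filterS _ (nbhs p) (nbhs_filter p) _ _ _ nb) => q [] /=.
rewrite /cylinder /= /word_length !size_segment; exact: nS.
Qed.

Lemma open_measurable_geodesics (S : set (double_boundary Sigma)) :
  open S -> measurable S.
Proof. by move=> oS; apply: sub_sigma_algebra. Qed.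

Lemma source_target_neq p : source p <> target p.
Proof. by have /set_mem := valP p. Qed.

(** The vertex where the rays from 1 to the two ends separate, which is the point of the geodesic
    closest to 1. *)
Lemma branch_point p : exists k, src p k = tgt p k /\
  forall a b, (dist (src p (k + a)) (tgt p (k + b)) = a + b)%N.
Proof.
have [k [ec nc]] : exists k, src p k = tgt p k /\ src p k.+1 <> tgt p k.+1.
  apply: contrapT => nex; apply: (@source_target_neq p).
  apply: segment_inj; elim => [|n IHn]; first exact: val_inj.
  by apply: contrapT => nn; apply: nex; exists n.
exists k; split=> // a b.
have := dist_lcp (src p (k + a)) (tgt p (k + b)); rewrite !size_segment.
suff -> : lcp (src p (k + a)) (tgt p (k + b)) = k by lia.
apply/eqP; rewrite eqn_leq; apply/andP; split; last first.
  have := lcp_ultra (src p (k + a)) (src p k) (tgt p (k + b)).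
  have l xi m : lcp (segment xi k) (segment xi (k + m)) = k.
    have := segment_btw xi (leq_addr m k).
    by rewrite -prefix_btw lcp_prefix size_segment => /eqP.
  by rewrite lcpC l ec l minnn.
case: a => [|a].
  by have := lcp_le (src p (k + 0)) (tgt p (k + b)); rewrite size_segment addn0.
case: b => [|b].
  have := lcp_le (tgt p (k + 0)) (src p (k + a.+1)).
  by rewrite lcpC size_segment addn0.
rewrite leqNgt; apply/negP => /lcp_take e; apply: nc.
rewrite /src /tgt -(@ftake_segment _ (source p) _ (k + a.+1)); last by lia.
rewrite -(@ftake_segment _ (target p) _ (k + b.+1)); last by lia.
exact: val_inj.
Qed.

(** A vertex [u] that is no farther from 1 than [x] branches off the segment from 1 to [y] no later
    than at [x]. *)
Lemma btw_far x y u : btw x 1 y -> size u <= size x -> btw x u y.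
Proof.
rewrite /btw !dist1 => bx ux; have := dist_four u x 1 y.
have := dist_triangle u x y; have := @dist_eq0 _ u x.
rewrite (distC u 1) (distC x 1) !dist1.
by case: (dist u x) => [/(_ erefl)->|]; rewrite ?distxx; lia.
Qed.

(** Together with [dist_cylinder2], this replaces the existence of a parametrized geodesic by an
    equality of distances at a single finite depth. *)
Lemma cylinder2_dist u v p m : cylinder2 u v p -> size u <= m -> size v <= m ->
  (dist (src p m) (tgt p m) = dist (src p m) u + dist u v + dist v (tgt p m))%N.
Proof.
case=> gam [[geo cs ct] [i [j [ij ei ej]]]] um vm.
have [ns _ nsP] := cs m; have [nt _ ntP] := ct m.
(* Large enough for [gam] at [-n] and [n] to lie beyond depth [m] and to enclose the parameters [i]
   and [j]. *)
pose n := (ns + nt + `|i| + `|j|)%N.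
have ht : btw (tgt p m) 1 (gam (Posz n)).
  by rewrite -prefix_btw; apply: ntP; rewrite /= /n; lia.
have hs : btw (src p m) 1 (gam (- Posz n)%R).
  by rewrite -prefix_btw; apply: nsP; rewrite /= /n; lia.
have := btw_far ht (u := v); have := btw_far hs (u := u).
rewrite !size_segment => /(_ um)/btwP du /(_ vm)/btwP dv.
have gd a b : dist (gam a) (gam b) = `|(a - b)%R|%N := geo a b.
have := gd (- Posz n)%R (Posz n); have := gd (- Posz n)%R i.
have := gd j (Posz n); have := gd i j; rewrite ei ej.
have := dist_triangle (gam (- Posz n)%R) (src p m) (gam (Posz n)).
have := dist_triangle (src p m) (tgt p m) (gam (Posz n)).
have := dist_triangle (src p m) u (tgt p m).
have := dist_triangle u v (tgt p m).
rewrite (distC u (gam _)) (distC u (src p m)) (distC (src p m) (gam _)) in du.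
move: ij du dv; rewrite /n; clear.
move: (gam _) (gam (Posz _)) => A B.
lia.
Qed.

Lemma geodesic_exists p : exists k gam, [/\ is_geodesic_from_to gam p,
  forall n, n <= k -> src p n = tgt p n,
  forall n, k < n -> src p n = gam (- Posz (n - k))%R &
  forall n, k < n -> tgt p n = gam (Posz (n - k))].
Proof.
have [k [ek dk]] := branch_point p.
(* The branch point is placed at parameter 0; [Negz n] stands for [-(n+1)], whence the successor. *)
pose gam (z : int) := match z with
  | Posz n => tgt p (k + n) | Negz n => src p (k + n.+1) end.
have gs n : k < n -> src p n = gam (- Posz (n - k))%R.
  move=> kn; rewrite (_ : (- Posz (n - k))%R = Negz (n - k).-1); last by lia.
  by rewrite /gam; congr src; lia.
have gt n : k < n -> tgt p n = gam (Posz (n - k)).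
  by move=> kn; rewrite /gam; congr tgt; lia.
exists k, gam; split=> //; last first.
  move=> n nk; rewrite /src /tgt -(ftake_segment _ nk) -/(src p k) ek.
  exact: ftake_segment.
split.
- have ds xi m n : dist (segment xi m) (segment xi n) = (m - n) + (n - m).
    wlog mn : m n / m <= n => [th|].
      have [/th//|nm] := leqP m n; rewrite distC addnC; apply: th; exact: ltnW.
    have := btwP (segment_btw xi mn); rewrite !dist1 !size_segment; lia.
  move=> [m|m] [n|n]; rewrite /word_length -/(dist _ _).
  + rewrite ds; lia.
  + rewrite distC dk; lia.
  + rewrite dk; lia.
  + rewrite ds; lia.
- move=> m; exists m.+1 => // -[|n] // mn.
  rewrite (_ : (- Posz n.+1)%R = Negz n) // prefix_btw segment_btw //.
  by rewrite /= in mn; lia.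
- move=> m; exists m => // n mn.
  by rewrite prefix_btw segment_btw //; rewrite /= in mn; lia.
Qed.

Lemma dist_cylinder2 u v p n : size u < n -> size v < n ->
    (dist (src p n) (tgt p n) = dist (src p n) u + dist u v + dist v (tgt p n))%N ->
  cylinder2 u v p.
Proof.
move=> un vn d.
(* The strict inequality on [size u] is needed here: if the two segments still coincided, [u] would
   be their common end, of length [n]. *)
have nst : src p n <> tgt p n.
  move=> e; move: d; rewrite e distxx => /esym d.
  have := @dist_eq0 _ (tgt p n) u; have := size_segment (target p) n.
  rewrite -/(tgt p n) => st h; have {}h : tgt p n = u by apply: h; lia.
  by rewrite h in st; lia.
have [k [gam [gamP st gs gt]]] := geodesic_exists p.
have kn : k < n by rewrite ltnNge; apply/negP => /st.
have gd a b : dist (gam a) (gam b) = `|(a - b)%R|%N.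
  by have [geo _ _] := gamP; apply: geo.
rewrite gs // gt // in d.
set A := gam _ in d; set B := gam _ in d.
have dAB : dist A B = ((n - k) * 2)%N by rewrite gd; lia.
have tuB := dist_triangle u v B; have tAu := dist_triangle A u B.
have tAv := dist_triangle A u v; have tvB := dist_triangle A v B.
pose i := (Posz (dist A u) - Posz (n - k))%R.
pose j := (i + Posz (dist u v))%R.
have gi : gam i = u.
  apply: (@btw_uniq _ _ _ A B); rewrite /btw ?gd /i; move: d dAB tuB tAu; clear; lia.
have gj : gam j = v.
  apply: (@btw_uniq _ _ _ A B); rewrite /btw ?gd /j /i;
    move: d dAB tuB tAu tAv tvB; clear; lia.
exists gam; split=> //; exists i, j; split=> //.
by rewrite /j; lia.
Qed.

End Geodesics.

(** * Preimages of the set of geodesics through 1 *)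

Section Preimages.
Local Open Scope classical_set_scope.
Local Open Scope nat_scope.
Local Open Scope group_scope.
Variable Sigma : free_basis.
Local Notation F := (freeGroup Sigma).
Implicit Types (x y z c g h u v : F) (xi zeta : boundary Sigma).
Implicit Types p q : double_boundary Sigma.
Implicit Types Phi Psi : automorphism F.

Lemma open_cylinder2 u v : open (cylinder2 u v : set (double_boundary Sigma)).
Proof.
apply: open_local => p puv; pose n := (size u + size v).+1; exists n.
move=> q sq tq; apply: (@dist_cylinder2 _ _ _ _ n); rewrite ?sq ?tq /n; try lia.
by apply: cylinder2_dist puv _ _; lia.
Qed.

Lemma lcp_le_btw c x y : btw c x y -> lcp x y <= size c.
Proof.
move=> /btwP; have := dist_lcp x y; have := dist_triangle 1 c x.
have := dist_triangle 1 c y; rewrite !dist1 (distC x c); lia.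
Qed.

(** The ends of a segment through [c] may move freely inside their components of the tree with [c]
    removed. *)
Lemma btw_move c x y x' y' : btw c x y -> ~~ btw c x x' -> ~~ btw c y y' ->
  btw c x' y'.
Proof.
move=> /(btw_split x')/orP[->//|b] _ nb.
by have /orP[//|] := btw_split y' b; rewrite btwC (negPf nb).
Qed.

Lemma dist_not_btw c x y : dist x y < dist x c -> ~~ btw c x y.
Proof. by rewrite /btw; lia. Qed.

Lemma aut_escapeD Phi c r : exists n, forall x, n <= size x -> r < dist (Phi x) c.
Proof.
have [n nP] := aut_escape Phi (r + size c).+1; exists n => x /nP.
have := dist_triangle 1 c (Phi x); rewrite !dist1 distC; lia.
Qed.

(** A common image ray would make the images of the two tails share a prefix too long for the
    cancellation allowed at the branch point. *)
Lemma extend_neq Phi p : extend Phi (source p) <> extend Phi (target p).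
Proof.
move=> e; have [k [ek dk]] := branch_point p.
pose r := (size (Phi (src p k)) + bcc Phi).+1.
have [n1 _ h1] := extendP Phi (source p) r.
have [n2 _ h2] := extendP Phi (target p) r.
pose n := (n1 + n2)%N.
have {}h1 : btw (segment (extend Phi (source p)) r) 1 (Phi (src p (k + n))).
  by rewrite -prefix_btw; apply: h1; rewrite /= /n; lia.
have {}h2 : btw (segment (extend Phi (source p)) r) 1 (Phi (tgt p (k + n))).
  by rewrite -prefix_btw e; apply: h2; rewrite /= /n; lia.
have : btw (src p k) (src p (k + n)) (tgt p (k + n)).
  have := dk n n; have := dk n 0; have := dk 0 n; rewrite !addn0 /btw -ek; lia.
move=> /(bccP Phi); move: (btwP h1) (btwP h2); rewrite !dist1 !size_segment.
have := dist_triangle 1 (Phi (src p k)) (Phi (src p (k + n))).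
have := dist_triangle 1 (Phi (src p k)) (Phi (tgt p (k + n))).
have := dist_triangle (Phi (src p (k + n))) (segment (extend Phi (source p)) r)
  (Phi (tgt p (k + n))).
rewrite !dist1 (distC _ (segment _ _)) /r; lia.
Qed.

Lemma extend2P Phi p : source (extend2 Phi p) = extend Phi (source p) /\
  target (extend2 Phi p) = extend Phi (target p).
Proof.
have pin : (extend Phi (source p), extend Phi (target p)) \in
    [set q : boundary Sigma * boundary Sigma | q.1 <> q.2].
  exact/mem_set/extend_neq.
rewrite /extend2; set S := [set q | _].
exact: (@xgetPex _ p S (ex_intro S (SigSub pin) (conj erefl erefl))).
Qed.

Lemma btw1 x y : btw 1 x y = (lcp x y == 0).
Proof.
have := dist_lcp x y; rewrite /btw (distC x 1) !dist1; lia.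
Qed.

Lemma cylinder2_11 p : cylinder2 1 1 p <-> lcp (src p 1) (tgt p 1) = 0.
Proof.
have d1 := dist_lcp (src p 1) (tgt p 1).
split=> [p1|e].
  have := cylinder2_dist p1 (m := 1) isT isT.
  by move: d1; rewrite (distC _ 1) distxx !dist1 !size_segment; lia.
apply: (@dist_cylinder2 _ _ _ _ 1) => //.
by move: d1; rewrite (distC _ 1) distxx !dist1 !size_segment e; lia.
Qed.

Lemma lcp_eq0_prefix (s t s' t' : seq (Sigma * bool)) : 0 < size s -> 0 < size t ->
  prefix s s' -> prefix t t' -> (lcp s t == 0) = (lcp s' t' == 0).
Proof.
case: s s' t t' => [|a s] [|a' s'] [|b t] [|b' t'] //= _ _.
by move=> /andP[/eqP-> _] /andP[/eqP-> _]; case: ifP.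
Qed.

(* Psi is z Phi z^-1, whose boundary map is the one of Phi followed by z. *)
Lemma preimage_cylinder2 Phi Psi z p : (forall x, Psi x = z * Phi x * z^-1) ->
  cylinder2 1 1 (extend2 Psi p) <->
  exists n0, forall n, n0 <= n -> btw z^-1 (Phi (src p n)) (Phi (tgt p n)).
Proof.
move=> PsiE; have [es et] := extend2P Psi p.
rewrite cylinder2_11 /src /tgt es et.
have [ns _ nsP] := extendP Psi (source p) 1%N.
have [nt _ ntP] := extendP Psi (target p) 1%N.
have [nz nzP] := aut_escapeD Phi z^-1 (2 * size z).
have conjE n : ns + nt + nz <= n ->
    (lcp (segment (extend Psi (source p)) 1) (segment (extend Psi (target p)) 1) == 0)
    = btw z^-1 (Phi (src p n)) (Phi (tgt p n)).
  move=> nn; rewrite (@lcp_eq0_prefix _ _ (Psi (src p n)) (Psi (tgt p n)))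
    ?size_segment //; first last.
  - by apply: ntP; rewrite /=; lia.
  - by apply: nsP; rewrite /=; lia.
  rewrite -btw1 !PsiE -(btwM z^-1) mulg1 -!mulgA !mulKg.
  have zz x : dist x (x * z^-1) = size z by rewrite dist_mulr /= size_invw.
  have := nzP (src p n); have := nzP (tgt p n); rewrite !size_segment.
  have le : nz <= n by lia.
  move=> /(_ le) + /(_ le).
  (* Right multiplication by [z^-1] moves a vertex by [size z]; at distance more than twice that,
     neither the vertex nor its translate can reach [z^-1] by such a move. *)
  have far x : 2 * size z < dist x z^-1 ->
      ~~ btw z^-1 x (x * z^-1) /\ ~~ btw z^-1 (x * z^-1) x.
    move=> dx; have tx := dist_triangle x (x * z^-1) z^-1.
    by split; apply: dist_not_btw; have := zz x; rewrite 1?(distC _ x); lia.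
  move=> /far[nB nB'] /far[nA nA'].
  by apply/idP/idP => b; apply: btw_move b _ _.
split=> [e|[n0 n0P]].
  by exists (ns + nt + nz) => n /conjE <-; rewrite e.
by apply/eqP; rewrite (conjE (n0 + (ns + nt + nz))%N) ?leq_addl // n0P ?leq_addr.
Qed.

(** Once the images of the initial segments are longer than [bcc Psi], prolonging the rays cannot
    carry them across 1, so membership is decided at that depth. *)
Lemma open_preimage_cylinder2 Psi :
  open (extend2 Psi @^-1` (cylinder2 1 1 : set (double_boundary Sigma))).
Proof.
have PsiE x : Psi x = 1 * Psi x * 1^-1 by rewrite mul1g invg1 mulg1.
apply: open_local => p /(preimage_cylinder2 _ PsiE)[n0 n0P].
have [n nP] := aut_escape Psi (bcc Psi).+1.
pose m := (n0 + n)%N; exists m => q sq tq; apply/(preimage_cylinder2 _ PsiE).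
have nb xi k : m <= k -> ~~ btw 1^-1 (Psi (segment xi m)) (Psi (segment xi k)).
  move=> mk; apply/negP => /lcp_le_btw; have := lcp_aut_segment Psi xi mk.
  by have := nP (segment xi m); rewrite size_segment invg1 /m /=; lia.
exists m => k mk; apply: (@btw_move _ (Psi (src q m)) (Psi (tgt q m))).
- by rewrite sq tq; apply: n0P; rewrite /m; lia.
- exact: nb.
- exact: nb.
Qed.

End Preimages.

(** * Extraction of separated subsequences *)

Section Separation.
Local Open Scope nat_scope.

(** Greedy choice: keep the head, discard the at most [B] entries related to it, itself included,
    and continue with the rest. *)
Lemma separated_subseq (T : eqType) (e : rel T) (B : nat) (s : seq T) :
    symmetric e -> reflexive e -> (forall x, count (e x) s <= B) ->
  exists s', [/\ subseq s' s, size s <= B * size s' &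
                 pairwise (fun x y => ~~ e x y) s'].
Proof.
move=> e_sym e_refl; have [n] := ubnP (size s); elim: n s => // n IHn [|x s].
  by exists [::]; rewrite muln0.
rewrite /= ltnS => sn sB; pose s1 := [seq y <- s | predC (e x) y].
have s1s : subseq s1 s by apply: filter_subseq.
have [||s2 [ss2 sz2 p2]] := IHn s1.
- by apply: leq_ltn_trans sn; rewrite size_filter count_size.
- move=> y; apply: leq_trans (sB y); apply: leq_trans (leq_addl _ _).
  by rewrite count_filter; apply: sub_count => z /andP[].
exists (x :: s2); split=> /=.
- by rewrite eqxx (subseq_trans ss2).
- rewrite mulnS -add1n -(count_predC (e x) s) addnA leq_add //.
    by have := sB x; rewrite e_refl.
  by rewrite -size_filter.
- rewrite p2 andbT; apply/allP => y /(mem_subseq ss2).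
  by rewrite mem_filter => /andP[].
Qed.

End Separation.

(** * Minimal conjugates and words without cancellation *)

Section MinimalRepresentatives.
Local Open Scope nat_scope.
Local Open Scope group_scope.
Variable Sigma : finType.
Local Notation F := (freeGroup Sigma).
Implicit Types (x y z c g h u v w : F) (a b : Sigma * bool).
Implicit Types Phi Psi : automorphism F.

Lemma ball_bound n : exists B, forall x (s : seq F), uniq s ->
  count (fun y => dist x y < n) s <= B.
Proof.
pose words := flatten
  [seq [seq tval t | t <- enum {: i.-tuple (Sigma * bool)}] | i <- iota 0 n].
exists (size words) => x s us; rewrite -size_filter.
rewrite -(size_map (fun y => word (x^-1 * y))); apply: uniq_leq_size.
  rewrite map_inj_uniq ?filter_uniq // => y y' e.
  exact/(mulgI x^-1)/val_inj.
move=> _ /mapP[y + ->]; rewrite mem_filter => /andP[dn _].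
apply/flattenP; exists [seq tval t | t <- enum {: (dist x y).-tuple (Sigma * bool)}].
  by apply/mapP; exists (dist x y); rewrite // mem_iota.
by apply/mapP; exists (in_tuple (word (x^-1 * y))); rewrite // mem_enum.
Qed.

Lemma conjugate_autE v Phi x : conjugate_aut v Phi x = v * Phi x * v^-1.
Proof. by []. Qed.

Definition total_stretch Phi : nat :=
  \sum_(a : Sigma * bool) size (Phi (free_letter a)).

Definition minimal Phi : Prop :=
  forall v, total_stretch Phi <= total_stretch (conjugate_aut v Phi).

Lemma minimal_conjugate Phi : exists v, minimal (conjugate_aut v Phi).
Proof.
pose P n := `[< exists v, total_stretch (conjugate_aut v Phi) = n >].
have Pex : exists n, P n.
  by exists (total_stretch (conjugate_aut 1 Phi)); apply/asboolP; exists 1.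
have [n /asboolP[v vn] nmin] := ex_minnP Pex; exists v => u; rewrite vn.
apply: nmin; apply/asboolP; exists (u * v); apply: eq_bigr => a _.
by rewrite !conjugate_autE invgM !mulgA.
Qed.

Lemma free_letterV a : free_letter (linv a) = (free_letter a)^-1.
Proof. exact: val_inj. Qed.

Lemma free_letter_neq1 a : free_letter a <> 1.
Proof. by move=> /(congr1 (@word Sigma)). Qed.

Lemma ohead_btw b x : (ohead (word x) == Some b) = btw (free_letter b) 1 x.
Proof.
by rewrite -prefix_btw; case: (word x) => [|a s] //=; rewrite prefix0s andbT eq_sym.
Qed.

(** Moving an end of the segment from 1 to [x] by one edge costs 1, or gains 1 if the move is
    inward. The excluded case [l = x], [y = 1] is that of a single edge whose ends are exchanged. *)
Lemma dist_step_inward l x y : dist 1 l = 1%N -> dist x y = 1%N -> x <> 1 ->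
  (l = x -> y <> 1) ->
  dist l y + 2 * btw l 1 x + 2 * btw y x 1 <= dist 1 x + 2.
Proof.
move=> d1l dxy nx1 nlx.
have x0 : 0 < dist 1 x by rewrite lt0n; apply/eqP => /dist_eq0 /esym.
have t1 := dist_triangle l 1 y; have t2 := dist_triangle 1 x y.
have t3 := dist_triangle l x y.
rewrite /btw (distC y 1) (distC x 1); rewrite (distC l 1) in t1.
case: eqP => b1; case: eqP => b2; try lia.
have := dist_four l y 1 x; rewrite (distC l 1) (distC y x) (distC y 1) dxy.
have [lx|/eqP nl] := eqVneq l x; last first.
  have := @dist_eq0 _ l x; case: (dist l x) b1 => [|n] b1 h; last by lia.
  by case: nl; apply: h.
have : dist 1 y <> 0 by move=> /dist_eq0 /esym; apply: nlx.
by subst l; rewrite distxx in b1 *; lia.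
Qed.

(** After translation by [b], the conjugate has as length the distance from [b] to [x b]. The
    exceptional case of [dist_step_inward] would require [b b = 1]. *)
Lemma size_conj_letter b x : x <> 1 ->
  size (word ((free_letter b)^-1 * x * (free_letter b)^-1^-1)%g)
   + 2 * (ohead (word x) == Some b) + 2 * (ohead (word x^-1%g) == Some b)
   <= size x + 2.
Proof.
move=> nx1; rewrite invgK !ohead_btw -(dist1 x) -(btwM x _ 1 x^-1) mulg1 mulgV -mulgA.
apply: dist_step_inward => //; first by rewrite dist_mulr.
by move=> <- /(congr1 (@word Sigma)) /=; case: eqP => // /(congr1 snd) /=; case: b.2.
Qed.

Definition first_letter Phi a := ohead (word (Phi (free_letter a))).

Lemma aut_letter_neq1 Phi a : Phi (free_letter a) <> 1.
Proof.
rewrite -(morph1 (aut_morph Phi)) => /(@aut_inj _ Phi); exact: free_letter_neq1.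
Qed.

(** Conjugation by [b^-1] changes the total length by at most [4k - 4m], with [m] the number of
    images starting with [b]: each is counted once for its letter and once for the inverse letter.
    Minimality makes this nonnegative. *)
Lemma minimal_first_letter Phi b : minimal Phi ->
  #|[set a | first_letter Phi a == Some b]| <= #|Sigma|.
Proof.
move=> minPhi; pose v := (free_letter b)^-1; have := minPhi v.
pose f a : nat := first_letter Phi a == Some b.
have fE : \sum_a f a = #|[set a | first_letter Phi a == Some b]|.
  by rewrite -sum1_card [RHS]big_mkcond; apply: eq_bigr => a _; rewrite /f inE; case: ifP.
have fV : \sum_a f (linv a) = \sum_a f a.
  by rewrite [RHS](reindex_inj (inv_inj (@linvK Sigma))).
have cA : (\sum_(a : Sigma * bool) 2 = 4 * #|Sigma|)%N.
  by rewrite sum_nat_const card_prod card_bool; lia.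
have : (total_stretch (conjugate_aut v Phi) +
    \sum_a 2 * f a + \sum_a 2 * f (linv a) <=
    total_stretch Phi + \sum_(a : Sigma * bool) 2)%N.
  rewrite /total_stretch -!big_split; apply: leq_sum => a _.
  have := size_conj_letter b (@aut_letter_neq1 Phi a).
  by rewrite -(morphV (aut_morph Phi)) -(free_letterV a); apply.
rewrite -!big_distrr /= fV fE cA.
have arith (t t' m k : nat) : t' + 2 * m + 2 * m <= t + 4 * k -> t <= t' -> m <= k.
  by lia.
exact: arith.
Qed.

(* Otherwise more than half of the letters would have images starting like the
   image of a. *)
Lemma legal_continuation Phi a : minimal Phi -> exists d,
  first_letter Phi d <> first_letter Phi (linv a) /\
  first_letter Phi (linv d) <> first_letter Phi a.
Proof.
move=> minPhi.
have [e|ne] := eqVneq (first_letter Phi a) (first_letter Phi (linv a)); last first.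
  by exists a; split; apply/eqP; rewrite // eq_sym.
have [b eb] : exists b, first_letter Phi a = Some b.
  rewrite /first_letter; case ew : (word _) => [|b s]; last by exists b.
  by case: (@aut_letter_neq1 Phi a); apply: val_inj.
apply: contrapT => none; have := minimal_first_letter b minPhi.
set S := [set d | _]; have aS : a \in S by rewrite inE eb.
have laS : linv a \in S by rewrite inE -e eb.
(* Without a continuation, inversion maps the complement of [S] into [S] and misses [a], whose
   inverse is in [S]; hence [S] has more than [k] elements. *)
have : #|(@linv Sigma) @: (~: S)| < #|S|.
  apply: proper_card; apply/properP; split; last first.
    exists a => //; apply/imsetP => -[d]; rewrite finset.in_setC => ncS ac.
    by rewrite ac linvK (negPf ncS) in laS.
  apply/fintype.subsetP => _ /imsetP[d ncS ->]; rewrite finset.in_setC inE in ncS.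
  apply: contrapT => nlc; apply: none; exists d; rewrite -e eb.
  by split; apply/eqP => //; move: nlc; rewrite inE => /negP.
rewrite (card_imset _ (inv_inj (@linvK Sigma))).
have := cardsC S; rewrite card_prod card_bool; lia.
Qed.

Lemma size_mul_nocancel x y : ohead (word x^-1) <> ohead (word y) -> x <> 1 ->
  size (word (x * y)%g) = size x + size y /\ ohead (word (x * y)) = ohead (word x).
Proof.
move=> nc nx1.
have l0 : lcp (word x^-1) (word y) = 0.
  case: (word x^-1) (word y) nc => [|a s] [|b t] //= nab.
  by case: eqP => // ab; case: nab; rewrite ab.
have e : size (word (x * y)) = size x + size y.
  have := dist_lcp x^-1 y; rewrite l0 /dist invgK muln0 addn0 => ->.
  by rewrite /= size_invw.
split=> //; have : prefix x (x * y).
  by rewrite prefix_btw /btw dist_mulr !dist1 e.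
have : size x <> 0 by move=> /size0nil ex; apply: nx1; apply: val_inj.
by case: (word x) (word (x * y)) => [|a s] [|b t] //= _ /andP[/eqP->].
Qed.

Lemma size_alternating x y m : x <> 1 -> y <> 1 ->
    ohead (word x^-1) <> ohead (word y) -> ohead (word y^-1) <> ohead (word x) ->
  size (word ((x * y) ^+ m)) = (m * (size x + size y))%N.
Proof.
(* The first letter of the power is carried along because it decides whether the next product
   cancels. *)
move=> nx1 ny1 xy yx; suff [] : size (word ((x * y) ^+ m)) = (m * (size x + size y))%N /\
  ohead (word ((x * y) ^+ m)) = if m is 0 then None else ohead (word x) by [].
elim: m => [|m [IHs IHo]] //; rewrite expgS -mulgA.
have [|s1 o1] := @size_mul_nocancel y ((x * y) ^+ m) _ ny1.
  rewrite IHo; case: (m) => // e; apply: ny1; apply: val_inj => /=.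
  by apply: size0nil; rewrite -size_invw; move: e => /=; case: (invw _).
have [|s2 ->] := @size_mul_nocancel x (y * (x * y) ^+ m) _ nx1; first by rewrite o1.
by rewrite s2 s1 IHs mulSn addnA.
Qed.
End MinimalRepresentatives.

(** * Segments whose image robustly crosses a vertex *)

Section Crossing.
Local Open Scope classical_set_scope.
Local Open Scope nat_scope.
Local Open Scope group_scope.
Variable Sigma : free_basis.
Local Notation F := (freeGroup Sigma).
Implicit Types (x y z c g h u v w : F).
Implicit Types p q : double_boundary Sigma.
Variable Phi : automorphism F.

(** The margins at both ends ensure that prolonging the segment from [x] to [x'] cannot cancel the
    passage of its image through [c]. *)
Definition crosses c x x' : Prop := [/\ btw c (Phi x) (Phi x'),
  bcc Phi < dist (Phi x) c & bcc Phi < dist (Phi x') c].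

Lemma crosses_avoid c x x' y : crosses c x x' -> btw x y x' ->
  ~~ btw c (Phi x) (Phi y).
Proof. by case=> b d _ bx; apply: bcc_avoid bx d b. Qed.

Lemma crosses_avoid' c x x' y : crosses c x x' -> btw x' x y ->
  ~~ btw c (Phi x') (Phi y).
Proof.
by case=> b _ d bx; apply: (bcc_avoid _ d); [rewrite btwC; apply: bx|rewrite btwC].
Qed.

(** With [c] removed, [Phi x], [Phi s] and [Phi y] are on the same side, since [s] lies behind both
    segments. If [y] came after [x'], then [Phi y] would be on the side of [Phi x'], the opposite
    one. *)
Lemma crosses_unique c x x' y y' s : crosses c x x' -> crosses c y y' ->
  btw x s x' -> btw y s y' -> ~~ btw x' x y.
Proof.
move=> cx cy bx by'; apply/negP => bxy.
have [b _ _] := cx.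
have nx := crosses_avoid cx bx; have ny := crosses_avoid cy by'.
have nxy : ~~ btw c (Phi x) (Phi y).
  by apply/negP => /(btw_split (Phi s)); rewrite (negPf nx) btwC (negPf ny).
have nx'y := crosses_avoid' cx bxy.
by have := btw_split (Phi y) b; rewrite (negPf nxy) btwC (negPf nx'y).
Qed.

Lemma btw_chain x x' s t :
    (dist s t = dist s x + dist x x' + dist x' t)%N ->
  [/\ btw x s x', btw x' x t, btw x s t & btw x' s t].
Proof.
move=> d; have := dist_triangle s x x'; have := dist_triangle x x' t.
have := dist_triangle s x' t; have := dist_triangle s x t.
by rewrite /btw; split; lia.
Qed.

Lemma crosses_cylinder2 c x x' p n : crosses c x x' -> cylinder2 x x' p ->
    size x <= n -> size x' <= n ->
  btw c (Phi (src p n)) (Phi (tgt p n)).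
Proof.
move=> cx xp xn xn'.
have [b1 b2 _ _] := btw_chain (cylinder2_dist xp xn xn').
have [b _ _] := cx; apply: btw_move b (crosses_avoid cx b1) _.
exact: crosses_avoid' cx b2.
Qed.

Lemma btw_line x y s t : btw x s t -> btw y s t -> dist s x <= dist s y ->
  btw x s y.
Proof.
rewrite /btw; have := dist_four x y s t; have := dist_triangle s x y.
rewrite (distC x s) (distC y s); lia.
Qed.

(** On a common geodesic, starting points at distance at least [n] make the later segment begin no
    earlier than the end of the first, against [crosses_unique]. By symmetry [x] is taken closer to
    the source. *)
Lemma crosses_disjoint c x x' y y' n : crosses c x x' -> crosses c y y' ->
    dist x x' = n -> dist y y' = n -> n <= dist x y ->
  forall p, cylinder2 x x' p -> cylinder2 y y' p -> False.
Proof.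
move=> + + + + + p.
wlog le : x x' y y' / dist (src p (size x + size x' + size y + size y')) x <=
                      dist (src p (size x + size x' + size y + size y')) y.
  move=> th cx cy dx dy dxy px py.
  have [le|/ltnW le] := leqP (dist (src p (size x + size x' + size y + size y')) x)
    (dist (src p (size x + size x' + size y + size y')) y).
    exact: (th x x' y y').
  apply: (th y y' x x') => //; last by rewrite distC.
  move: le; rewrite (_ : size y + size y' + size x + size x' =
                         size x + size x' + size y + size y')%N //; lia.
move: le; set m := (size x + _ + _ + _)%N => le cx cy dx dy dxy px py.
have [||b1 b2 b3 b4] := btw_chain (cylinder2_dist px (m := m) _ _); rewrite /m; try lia.
have [||e1 e2 e3 e4] := btw_chain (cylinder2_dist py (m := m) _ _); rewrite /m; try lia.
have := crosses_unique cx cy b1 e1; move/negP; apply.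
have bxy := btw_line b3 e3 le.
have l1 := btwP bxy; have l2 := btwP b1.
have bx'y : btw x' (src p m) y by apply: btw_line b4 e3 _; lia.
exact: btw_midl bx'y b1.
Qed.

End Crossing.

(** * Many separated crossings for a minimal automorphism *)

Section CrossingCount.
Local Open Scope classical_set_scope.
Local Open Scope nat_scope.
Local Open Scope group_scope.
Variable Sigma : free_basis.
Local Notation F := (freeGroup Sigma).
Implicit Types (x y z c g h u v w : F).
Implicit Types Phi Psi : automorphism F.

Lemma morphX Phi x n : Phi (x ^+ n) = Phi x ^+ n.
Proof.
elim: n => [|n IHn]; first by rewrite !expg0 (morph1 (aut_morph Phi)).
by rewrite !expgS aut_morph IHn.
Qed.

Lemma crosses_middle Phi c u w i : Phi u * ftake i (Phi w) = c ->
  bcc Phi < i -> i + bcc Phi < size (Phi w) -> crosses Phi c u (u * w).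
Proof.
move=> <- Ki iK; have iw : i <= size (Phi w) by lia.
have b : btw (Phi u * ftake i (Phi w)) (Phi u) (Phi (u * w)).
  by rewrite aut_morph -(btwM (Phi u)^-1) !mulKg mulVg ftake_btw.
have d1 : dist (Phi u) (Phi u * ftake i (Phi w)) = i.
  by rewrite dist_mulr size_takel.
split=> //; first by rewrite d1.
have := btwP b; rewrite d1 aut_morph dist_mulr distC; lia.
Qed.

(** The constants are chosen before [Phi] and [c]: this is what makes the lower bound on the length
    uniform over all minimal automorphisms. *)
Lemma separated_crossings : exists l B : nat, 0 < l /\
  forall Phi c, minimal Phi -> exists w (s : seq F),
  [/\ size w = l, stretch Phi <= B * size s,
      forall x, x \in s -> crosses Phi c x (x * w) &
      pairwise (fun x y => l <= dist x y) s].
Proof.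
(* With [N = stretch Phi >= 1], the margins [2 * bcc Phi] and [N] further vertices add up to at most
   [8kN + 3N], which is less than [mN]. *)
pose m := (8 * #|Sigma| + 4)%N.
have [B BP] := ball_bound Sigma (m * 2); exists (m * 2)%N, B; split=> [|Phi c minPhi].
  by rewrite /m; lia.
have [a eN] : exists a, stretch Phi = size (Phi (free_letter a)).
  have [|a ea] := @eq_bigmax _ (fun a => size (Phi (free_letter a))).
    by rewrite card_prod card_bool; have := rank_gt1 Sigma; lia.
  by exists a; rewrite -ea.
have [b [nba nab]] := legal_continuation a minPhi.
have neq1 := @aut_letter_neq1 _ Phi.
pose w := (free_letter a * free_letter b) ^+ m.
have sw : size w = (m * 2)%N.
  apply: size_alternating; try exact: free_letter_neq1.
    by rewrite -free_letterV => -[e]; rewrite e in nba.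
  by rewrite -free_letterV => -[e]; rewrite e in nab.
have sPw : (m * stretch Phi <= size (Phi w))%N.
  rewrite morphX aut_morph size_alternating ?eN //.
  - by rewrite leq_mul2l leq_addr orbT.
  - by rewrite -(morphV (aut_morph Phi)) -free_letterV; apply: nesym.
  - by rewrite -(morphV (aut_morph Phi)) -free_letterV.
have N0 : 0 < stretch Phi.
  rewrite eN lt0n; apply/eqP => /size0nil e; apply: (neq1 a); exact: val_inj.
pose i t := ((bcc Phi).+1 + t)%N.
(* The translate of [w] by [u t] is the one for which vertex number [i t] of its image falls on
   [c]. *)
have /boolp.choice[u uP] t : exists x, Phi x * ftake (i t) (Phi w) = c.
  have [x xP] := aut_surj Phi (c * (ftake (i t) (Phi w))^-1).
  by exists x; rewrite xP mulgVK.
have iK t : t < stretch Phi -> i t + bcc Phi < size (Phi w).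
  move=> tN; apply: leq_trans sPw; rewrite /i /m /bcc.
  have : (#|Sigma| <= #|Sigma| * stretch Phi)%N by rewrite leq_pmulr.
  rewrite mulnDl -mulnA mulnS; lia.
have u_inj s t : s < stretch Phi -> t < stretch Phi -> u s = u t -> s = t.
  move=> sN tN e; have := uP s.
  rewrite -(uP t) e => /mulgI /(congr1 (fun x : F => size x)).
  have := iK s sN; have := iK t tN; rewrite /= => ti si.
  rewrite !size_takel; [rewrite /i; lia | lia | lia].
have us : uniq [seq u t | t <- iota 0 (stretch Phi)].
  rewrite map_inj_in_uniq ?iota_uniq // => s t; rewrite !mem_iota /= => sN tN.
  exact: u_inj.
pose near : rel F := fun x y => dist x y < m * 2.
have near_sym : symmetric near by move=> x y; rewrite /near distC.
have near_refl : reflexive near by move=> x; rewrite /near distxx /m; lia.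
have [s [ss sz ps]] := separated_subseq near_sym near_refl (fun x => BP x _ us).
exists w, s; split=> //.
- by rewrite size_map size_iota in sz.
- move=> x /(mem_subseq ss)/mapP[t]; rewrite mem_iota /= => tN ->.
  by apply: crosses_middle (uP t) _ (iK t tN); rewrite /i; lia.
- by apply: sub_pairwise ps => x y; rewrite -leqNgt.
Qed.

End CrossingCount.

Import Order.TTheory GRing.Theory Num.Theory.

(** * Bounds on the length of an automorphism *)

Section LengthBounds.
Local Open Scope classical_set_scope.
Local Open Scope ring_scope.
Variables (R : realType) (Sigma : free_basis).
Variable eta : {measure set (double_boundary Sigma) -> \bar R}.
Hypothesis eta_uniform : is_uniform_current eta.
Local Notation F := (freeGroup Sigma).
Local Notation D := (double_boundary Sigma).
Implicit Types (x y z c g h u v w : F).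
Implicit Types Phi Psi : automorphism F.

Definition cylinder_mass (n : nat) : R :=
  1 / (2 * #|Sigma|%:R * (2 * #|Sigma|%:R - 1) ^+ (n - 1)).

Lemma cylinder_mass_gt0 n : 0 < cylinder_mass n.
Proof.
have k1 := rank_gt1 Sigma.
rewrite /cylinder_mass divr_gt0 // mulr_gt0 ?exprn_gt0 ?subr_gt0 //.
  by rewrite -natrM ltr0n; lia.
by rewrite -natrM ltr1n; lia.
Qed.

Lemma eta_cylinder2 x w : w <> 1%g ->
  eta (cylinder2 x (x * w)%g) = (cylinder_mass (size w))%:E.
Proof.
move=> w1; have [_ ->] := eta_uniform; first by rewrite /word_length mulKg.
by move=> e; apply: w1; apply: (mulgI x); rewrite mulg1 -e.
Qed.

Lemma measurable_cylinder2 x y : measurable (cylinder2 x y : set D).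
Proof. by apply: open_measurable_geodesics; apply: open_cylinder2. Qed.

Lemma measurable_preimage_cylinder2 Psi :
  measurable (extend2 Psi @^-1` (cylinder2 1%g 1%g : set D)).
Proof. by apply: open_measurable_geodesics; apply: open_preimage_cylinder2. Qed.

(** The preimage of the geodesics through 1 contains disjoint cylinders of equal mass, one for each
    separated crossing of [z^-1], and their number is at least proportional to [stretch Phi]. *)
Lemma aut_length_lower_bound : exists2 eps : R, 0 < eps &
  forall Phi Psi z, minimal Phi -> (forall x, Psi x = z * Phi x * z^-1)%g ->
  ((eps * (stretch Phi)%:R)%:E <= aut_length eta Psi)%E.
Proof.
have [l [B [l0 cross]]] := separated_crossings Sigma.
(* The successor keeps the denominator positive. *)
exists (cylinder_mass l / B.+1%:R); first by rewrite divr_gt0 ?cylinder_mass_gt0.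
move=> Phi Psi z minPhi PsiE.
have [w [s [sw Ns sP s_sep]]] := cross Phi z^-1%g minPhi.
have w1 : w <> 1%g by move=> e; rewrite e in sw; rewrite -sw in l0.
pose C x : set D := cylinder2 x (x * w)%g.
pose G i : set D := if (i < size s)%N then C (nth 1%g s i) else set0.
have mG i : measurable (G i).
  by rewrite /G; case: ifP => _; [apply: measurable_cylinder2|apply: measurable0].
have tG : trivIset setT G.
  suff disj i j p : (i < j)%N -> G i p -> G j p -> False.
    move=> i j _ _ [p [Gip Gjp]].
    have [lt|lt|//] := ssrnat.ltngtP i j; first by case: (disj i j p lt Gip Gjp).
    by case: (disj j i p lt Gjp Gip).
  rewrite /G => ij; case: ifP => // si; case: ifP => // sj.
  apply: (crosses_disjoint (n := l) (sP _ (mem_nth _ si)) (sP _ (mem_nth _ sj))).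
  - by rewrite dist_mulr.
  - by rewrite dist_mulr.
  - by have /(pairwiseP 1%g)/(_ i j si sj ij) := s_sep.
have sub : \big[setU/set0]_(i < size s) G i `<=`
    extend2 Psi @^-1` cylinder2 1%g 1%g.
  rewrite -bigcup_mkord => p [i /= si]; rewrite /G si => Cp.
  apply/(preimage_cylinder2 p PsiE).
  exists (size (nth 1%g s i) + size (nth 1%g s i * w)%g)%N => n le.
  apply: (crosses_cylinder2 (sP _ (mem_nth _ si)) Cp).
    exact: leq_trans (leq_addr _ _) le.
  exact: leq_trans (leq_addl _ _) le.
have mass : eta (\big[setU/set0]_(i < size s) G i) =
    ((size s)%:R * cylinder_mass l)%:E.
  rewrite measure_bigsetU // (eq_bigr (fun=> (cylinder_mass l)%:E)).
    by rewrite sumEFin sumr_const card_ord mulr_natl.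
  by move=> i _; rewrite /G ltn_ord /C -sw; apply: eta_cylinder2.
have : (eta (\big[setU/set0]_(i < size s) G i) <= aut_length eta Psi)%E.
  apply: le_measure sub; rewrite inE; last exact: measurable_preimage_cylinder2.
  by apply: bigsetU_measurable.
apply: le_trans; rewrite mass lee_fin -mulrA [leRHS]mulrC.
rewrite ler_pM2l ?cylinder_mass_gt0 // mulrC ler_pdivrMr // -natrM ler_nat.
by apply: leq_trans Ns _; rewrite mulnC leq_mul2l leqnSn orbT.
Qed.

(** Every geodesic in the preimage has an edge whose image contains [z^-1]. By injectivity of [Phi]
    such an edge is determined by its letter and the position of [z^-1] on its image, so [#|T|]
    one-edge cylinders cover the preimage, whatever [z] is. *)
Lemma aut_length_upper_bound Phi : exists M : R, forall Psi z,
  (forall x, Psi x = z * Phi x * z^-1)%g -> (aut_length eta Psi <= M%:E)%E.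
Proof.
pose T : finType := ((Sigma * bool) * 'I_(stretch Phi).+1)%type.
exists (#|T|%:R * cylinder_mass 1) => Psi z PsiE.
have /boolp.choice[u uP] (t : T) :
    exists x, (Phi x * ftake t.2 (Phi (free_letter t.1)) = z^-1)%g.
  have [x xP] := aut_surj Phi (z^-1 * (ftake t.2 (Phi (free_letter t.1)))^-1)%g.
  by exists x; rewrite xP mulgVK.
pose L := [seq (u t, (u t * free_letter t.1)%g) | t <- enum {: T}].
have sL : size L = #|T| by rewrite size_map -cardE.
pose G i : set D := let p := nth (1%g, 1%g) L i in cylinder2 p.1 p.2.
have mG i : measurable (G i) by apply: measurable_cylinder2.
have sub : extend2 Psi @^-1` cylinder2 1%g 1%g `<=` \big[setU/set0]_(i < #|T|) G i.
  move=> p /(preimage_cylinder2 p PsiE)[n0 n0P].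
  have [n1 n1P] := aut_escapeD Phi z^-1%g 0.
  (* Beyond [n1] the image of the source segment has left [z^-1]; the last two terms put both ends
     of the edge strictly below depth [n]. *)
  pose n := (n0 + n1 + (\max_(t : T) size (u t)) + 2)%N.
  have bz : btw z^-1%g (Phi (src p n)) (Phi (tgt p n)) by apply: n0P; rewrite /n; lia.
  have nz : z^-1%g <> Phi (src p n).
    move=> e; have := n1P (src p n); rewrite size_segment -e distxx ltnn.
    by rewrite /n; lia.
  have [g [a [b1 b2 dga bg _]]] := first_edge nz bz.
  have [m em] := edge_point (aut_morph Phi) (stretch_max Phi) bg.
  pose t : T := (a, m).
  have eg : g = u t.
    apply: (@aut_inj _ Phi); apply: (@mulIg _ (ftake m (Phi (free_letter a)))).
    by rewrite -em; have := uP t.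
  have ut : (size (u t) <= \max_(t : T) size (u t))%N.
    exact: (leq_bigmax (F := fun t => size (u t))).
  rewrite -bigcup_mkord; exists (index t (enum {: T})).
    by rewrite /= cardE index_mem mem_enum.
  rewrite /G /L (nth_map t) ?index_mem ?mem_enum // nth_index ?mem_enum //=.
  rewrite -/(free_letter a) -eg; apply: (@dist_cylinder2 _ _ _ _ n).
  - by rewrite eg /n; lia.
  - have := dist_triangle 1%g g (g * free_letter a)%g.
    by rewrite !dist1 dist_mulr /= eg /n; lia.
  - have := btwP b1; have := btwP b2; rewrite dga dist_mulr /=; lia.
apply: (@le_trans _ _ (\sum_(i < #|T|) eta (G i))%E).
  apply: content_subadditive sub; last exact: measurable_preimage_cylinder2.
  by move=> i _; apply: mG.
rewrite (eq_bigr (fun=> (cylinder_mass 1)%:E)).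
  by rewrite sumEFin sumr_const card_ord mulr_natl.
move=> i _; have iT : (i < size (enum {: T}))%N by rewrite -cardE.
pose t := enum_val i.
rewrite /G /L (nth_map t) //=; apply: (@eta_cylinder2 _ (free_letter _)).
exact: free_letter_neq1.
Qed.

End LengthBounds.

(** * Subsequences and the pigeonhole principle *)

Section Subsequences.
Local Open Scope nat_scope.

Lemma infinite_subsequence (P : nat -> Prop) : (forall n, exists m, n <= m /\ P m) ->
  exists sigma : nat -> nat, {homo sigma : m n / m < n} /\ forall n, P (sigma n).
Proof.
move=> /boolp.choice[f fP]; exists (fun n => iter n (fun m => f m.+1) (f 0)); split.
  apply: homo_ltn => [a b d|n]; first exact: ltn_trans.
  by have [] := fP (iter n (fun m => f m.+1) (f 0)).+1.
by case=> [|n]; apply: (proj2 (fP _)).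
Qed.

Lemma infinite_pigeonhole (T : finType) (f : nat -> T) (P : nat -> Prop) :
    (forall n, exists m, n <= m /\ P m) ->
  exists t, forall n, exists m, n <= m /\ (P m /\ f m = t).
Proof.
move=> infP; apply: contrapT => none.
have /boolp.choice[b bP] (t : T) : exists n, forall m, n <= m -> P m -> f m <> t.
  apply: contrapT => nb; apply: none; exists t => n.
  apply: contrapT => nm; apply: nb; exists n => m nm' Pm fm.
  by apply: nm; exists m.
have [m [bm Pm]] := infP (\max_t b t).
by apply: (bP (f m) m) => //; apply: leq_trans bm; apply: leq_bigmax.
Qed.

End Subsequences.

(** * Finiteness of the automorphisms of bounded stretch *)

Section Automorphisms.
Local Open Scope group_scope.
Variable Sigma : finType.
Local Notation F := (freeGroup Sigma).
Implicit Types Phi Psi : automorphism F.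

Lemma aut_ext Phi Psi : (forall x, Phi x = Psi x) -> Phi = Psi.
Proof.
case: Phi Psi => [f fM fb] [g gM gb] /= /funext fg; rewrite fg in fM fb *.
by congr Automorphism; apply: Prop_irrelevance.
Qed.

Lemma aut_letters_ext Phi Psi :
  (forall a, Phi (free_letter a) = Psi (free_letter a)) -> Phi = Psi.
Proof.
move=> e; apply: aut_ext => x; have [n] := ubnP (dist 1 x).
elim: n x => // n IHn x; rewrite ltnS => xn.
have [<-|nx1] := pselect (1 = x); first by rewrite !(morph1 (aut_morph _)).
have [g [a [ex _ dg]]] := last_letter nx1.
by rewrite ex !aut_morph e IHn // -dg.
Qed.

(** A code in a finite type, to which the pigeonhole principle applies. Words longer than [r] get a
    default value, so it is faithful only when the stretch is at most [r]. *)
Definition aut_code r Phi : {ffun Sigma * bool -> {bseq r of Sigma * bool}} :=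
  [ffun a => insub_bseq r (word (Phi (free_letter a)))].

Lemma aut_code_inj r Phi Psi : (stretch Phi <= r)%N -> (stretch Psi <= r)%N ->
  aut_code r Phi = aut_code r Psi -> Phi = Psi.
Proof.
move=> Phir Psir e; apply: aut_letters_ext => a; apply: val_inj.
have /(congr1 (fun s : {bseq r of _} => val s)) :
  aut_code r Phi a = aut_code r Psi a by rewrite e.
rewrite !ffunE /= /insub_bseq !val_insubd.
by rewrite !(leq_trans (stretch_max _ _)).
Qed.

End Automorphisms.

(** * The dichotomy for sequences of automorphisms *)

Local Open Scope classical_set_scope.
Local Open Scope ring_scope.

Lemma cvg_automorphism (G : groupType) (u : nat -> automorphism G) Phi :
  u @ \oo --> Phi <-> exists n0, forall n, (n0 <= n)%N -> u n = Phi.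
Proof.
split=> [/(_ [set Phi])[] // n0 _ h|[n0 h] A AP].
  by exists n0 => n /h.
by exists n0 => // n /h; rewrite /preimage /= => ->; apply: AP.
Qed.

Theorem theorem1p1 (R : realType) (Sigma : free_basis)
  (eta_A : {measure set (double_boundary Sigma) -> \bar R})
  (eta_A_uniform : is_uniform_current eta_A)
  (Phi_ : nat -> automorphism (freeGroup Sigma)) :
  exists (sigma : nat -> nat) (v : nat -> freeGroup Sigma),
    {homo sigma : m n / (m < n)%N} /\
    let Psi_ := fun n => conjugate_aut (v n) (Phi_ (sigma n)) in
    let converges :=
      exists Phi : automorphism (freeGroup Sigma), Psi_ @ \oo --> Phi in
    let diverges := aut_length eta_A (Phi_ (sigma n)) @[n --> \oo] --> +oo%E in
    [/\ converges \/ diverges,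
        ~ (converges /\ diverges) &
        forall Phi : automorphism (freeGroup Sigma),
          Psi_ @ \oo --> Phi <->
          exists2 tau : nat -> nat, {homo tau : m n / (m < n)%N} &
            forall i, Psi_ (tau i) = Phi].
Proof.
have /boolp.choice[v vmin] n := minimal_conjugate (Phi_ n).
(* This presents [Phi_ n] as a conjugate of its minimal representative, the form required by both
   length bounds. *)
have PhiE n x : Phi_ n x = ((v n)^-1 * conjugate_aut (v n) (Phi_ n) x * (v n)^-1^-1)%g.
  by rewrite conjugate_autE invgK -!mulgA mulVg mulg1 mulKg.
have [[r rinf]|nbd] := pselect (exists r, forall n, exists m,
    (n <= m)%N /\ (stretch (conjugate_aut (v m) (Phi_ m)) <= r)%N).
  have [t tinf] := infinite_pigeonhole
    (fun n => aut_code r (conjugate_aut (v n) (Phi_ n))) rinf.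
  have [sigma [sigma_homo sigmaP]] := infinite_subsequence tinf.
  exists sigma, (fun n => v (sigma n)); split=> //=.
  pose Phi0 := conjugate_aut (v (sigma 0%N)) (Phi_ (sigma 0%N)).
  have const n : conjugate_aut (v (sigma n)) (Phi_ (sigma n)) = Phi0.
    have [rn tn] := sigmaP n; have [r0 t0] := sigmaP 0%N.
    by apply: (@aut_code_inj _ r) => //; rewrite tn t0.
  have cvg0 : (fun n => conjugate_aut (v (sigma n)) (Phi_ (sigma n))) @ \oo --> Phi0.
    by apply/cvg_automorphism; exists 0%N.
  split; first by left; exists Phi0.
    (* All terms of the subsequence are conjugates of [Phi0], so a single bound [M] holds for their
       lengths. *)
    move=> [_ div]; have [M MP] := aut_length_upper_bound eta_A_uniform Phi0.
    have [n _ /(_ n (leqnn n)) /=] := cvgey_ge div (M + 1).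
    rewrite leNgt => /negP; apply.
    apply: (@le_lt_trans _ _ M%:E); last by rewrite lte_fin ltrDl.
    by apply: (MP _ (v (sigma n))^-1%g) => x; rewrite -(const n) PhiE.
  move=> Phi; split=> [/cvg_automorphism[n0 n0P]|[tau _ tauP]].
    exists (fun i => (n0 + i)%N) => [m n|i]; first by rewrite ltn_add2l.
    by apply: n0P; rewrite leq_addr.
  by rewrite -(tauP 0%N) const.
have unbd r : exists n, forall m, (n <= m)%N ->
    (r < stretch (conjugate_aut (v m) (Phi_ m)))%N.
  apply: contrapT => nex; apply: nbd; exists r => n.
  apply: contrapT => nm; apply: nex; exists n => m le.
  by rewrite ltnNge; apply/negP => mr; apply: nm; exists m.
exists id, v; split=> //=.
(* A constant subsequence would have constant stretch. This refutes both sides of the last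
   equivalence. *)
have nosub Phi (tau : nat -> nat) : {homo tau : m n / (m < n)%N} ->
    ~ forall i, conjugate_aut (v (tau i)) (Phi_ (tau i)) = Phi.
  move=> tau_homo tauP; have [n nP] := unbd (stretch Phi).
  have le m : (m <= tau m)%N.
    by elim: m => // m IHm; apply: leq_ltn_trans IHm (tau_homo _ _ (ltnSn m)).
  by have := nP _ (le n); rewrite tauP ltnn.
have nocvg (Phi : automorphism (freeGroup Sigma)) :
    ~ ((fun n => conjugate_aut (v n) (Phi_ n)) @ \oo --> Phi).
  case/cvg_automorphism => n0 n0P; apply: (nosub Phi (fun i => (n0 + i)%N)).
    by move=> m n; rewrite ltn_add2l.
  by move=> i; apply: n0P; rewrite leq_addr.
split.
- right; apply/cvgeyPge => A.
  have [eps eps0 epsP] := aut_length_lower_bound eta_A_uniform.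
  (* From this rank on the stretch exceeds [A / eps], so the lower bound on the length exceeds
     [A]. *)
  have [n nP] := unbd (Num.bound `|A / eps|).
  exists n => // m /= nm; apply: le_trans (epsP _ _ _ (vmin m) (PhiE m)).
  rewrite lee_fin mulrC -ler_pdivrMr //; apply/ltW.
  apply: le_lt_trans (ler_norm _) _; apply: lt_le_trans (archi_boundP (normr_ge0 _)) _.
  by rewrite ler_nat; apply: ltnW; apply: nP.
- by move=> [[Phi /nocvg]].
- by move=> Phi; split=> [/nocvg|[tau ht /(nosub _ _ ht)]].
Qed.
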